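(* Let $\mathcal G=(V,\mathcal E)$ be a loopless graph. Then $\mathcal G$ is join-irreducible if and only if $\check{\mathcal G}$ is isomorphic to one of the following graphs: (i) a disjoint union of $n$ copies of $K_3$, for some $n\ge 2$; (ii) $C_5$; (iii) $K_2+\overline{K}_m$ for some $m\ge 2$; (iv) $K_n$ for some $n\ge 2$; (v) $\overline{K}_n+\overline{K}_m$ for some $n,m$ with $1\le n<m$; (vi) the graph join $\overline{K}_n+\cdots+\overline{K}_n$ of $r$ copies of $\overline{K}_n$, for some $r,n\ge 2$.
   Context: A loopless graph $\mathcal G=(V,\mathcal E)$ has finite vertex set $V=\{1,\dots,n\}$ and $\mathcal E\subseteq[V]^2$. $\check{\mathcal G}$ is the graph obtained by deleting the isolated vertices (those in no edge). $f_{\mathcal G}\colon\{0,1\}^n\to\{0,1\}$ is the function computed by the $GF(2)$ polynomial $\sum_{\{i,j\}\in\mathcal E}x_ix_j$, and $\mathcal G$ is join-irreducible if $f_{\mathcal G}$ is. For Boolean functions, $g\le f$ ($g$ of arity $m$, $f$ of arity $n$) if there is $\sigma\colon\{1,\dots,n\}\to\{1,\dots,m\}$ with $g(a_1,\dots,a_m)=f(a_{\sigma(1)},\dots,a_{\sigma(n)})$ for all $a_i$; $g<f$ if $g\le f$ and $f\not\le g$; $f$ is join-irreducible if some $f'<f$ satisfies $g\le f'$ for all $g<f$. $K_n$ is the complete graph, $\overline{K}_n$ the edgeless graph on $n$ vertices, $C_5$ the 5-cycle. The graph join $\mathcal G_1+\mathcal G_2$ is the disjoint union of $\mathcal G_1$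 and $\mathcal G_2$ together with all edges joining a vertex of $\mathcal G_1$ to a vertex of $\mathcal G_2$. *)

(* Defs.v *)
From mathcomp Require Import all_boot all_algebra.
From mathcomp Require Import mpoly.

Set Implicit Arguments.
Unset Strict Implicit.
Unset Printing Implicit Defensive.

(* The set {0,1} is the carrier of the field 'F_2 = GF(2). *)
Definition boolfun (n : nat) := {ffun 'I_n -> 'F_2} -> 'F_2.

Definition minor_le (m n : nat) (g : boolfun m) (f : boolfun n) : Prop :=
  exists sigma : 'I_n -> 'I_m,
    forall a : {ffun 'I_m -> 'F_2}, g a = f [ffun i => a (sigma i)].

Definition minor_lt (m n : nat) (g : boolfun m) (f : boolfun n) : Prop :=
  minor_le g f /\ ~ minor_le f g.

(* Boolean functions have positive arity. *)
Definition join_irreducible (n : nat) (f : boolfun n) : Prop :=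
  exists (m : nat) (f' : boolfun m),
    [/\ 0 < m, minor_lt f' f
      & forall (k : nat) (g : boolfun k),
          0 < k -> minor_lt g f -> minor_le g f'].

Definition loopless_edges (T : finType) (E : {set {set T}}) : Prop :=
  forall e : {set T}, e \in E -> #|e| = 2.

Record graph := Graph {
  vertex :> finType;
  edges : {set {set vertex}};
  edges_loopless : loopless_edges edges
}.

Definition graph_iso (G H : graph) : Prop :=
  exists2 phi : G -> H, bijective phi &
    forall e : {set G}, (phi @: e \in edges H) = (e \in edges G).

Definition edge_poly (n : nat) (E : {set {set 'I_n}}) : {mpoly 'F_2[n]} :=
  (\sum_(e in E) \prod_(i in e) 'X_i)%R.

Definition edge_fun (n : nat) (E : {set {set 'I_n}}) : boolfun n :=
  fun a => (edge_poly E).@[a]%R.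

Definition complete_edges (n : nat) : {set {set 'I_n}} :=
  [set e : {set 'I_n} | #|e| == 2].

Lemma complete_edgesP n : loopless_edges (complete_edges n).
Proof. by move=> e; rewrite inE => /eqP. Qed.

Definition complete_graph (n : nat) : graph := Graph (@complete_edgesP n).

Lemma edgeless_edgesP n : loopless_edges (set0 : {set {set 'I_n}}).
Proof. by move=> e; rewrite inE. Qed.

Definition edgeless_graph (n : nat) : graph := Graph (@edgeless_edgesP n).

(* ordS is the cyclic successor on 'I_5. *)
Definition C5_edges : {set {set 'I_5}} := [set [set i; ordS i] | i : 'I_5].

Lemma C5_edgesP : loopless_edges C5_edges.
Proof.
move=> e /imsetP[i _ ->]; rewrite cards2.
by case: i => [[|[|[|[|[|i]]]]] Hi].
Qed.

Definition C5 : graph := Graph C5_edgesP.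

Section Operations.
Variables G H : graph.

Definition disjoint_union_edges : {set {set G + H}} :=
  [set inl @: (e : {set G}) | e in edges G] :|:
  [set inr @: (e : {set H}) | e in edges H].

Lemma disjoint_union_edgesP : loopless_edges disjoint_union_edges.
Proof.
move=> e /setUP[] /imsetP[d dE ->]; rewrite card_imset ?(edges_loopless dE) //.
  exact: inl_inj.
exact: inr_inj.
Qed.

Definition disjoint_union : graph := Graph disjoint_union_edgesP.

Definition graph_join_edges : {set {set G + H}} :=
  disjoint_union_edges :|:
  [set [set inl x; inr y] | x in [set: G], y in [set: H]].

Lemma graph_join_edgesP : loopless_edges graph_join_edges.
Proof.
move=> e /setUP[/disjoint_union_edgesP //|/imset2P[x y _ _ ->]].
by rewrite cards2.
Qed.

Definition graph_join : graph := Graph graph_join_edgesP.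

Definition non_isolated : finType :=
  {x : G | [exists e in edges G, x \in e]}.

Definition delete_isolated_edges : {set {set non_isolated}} :=
  [set e : {set non_isolated} | [set sval x | x in e] \in edges G].

Lemma delete_isolated_edgesP : loopless_edges delete_isolated_edges.
Proof.
move=> e; rewrite inE => /edges_loopless <-; rewrite card_imset //.
exact: val_inj.
Qed.

Definition delete_isolated : graph := Graph delete_isolated_edgesP.

End Operations.

(* iterop r op G _ = op G (... (op G G)) with r >= 1 copies of G; the default
   value, used only for r = 0, is the graph with no vertices. *)
Definition disjoint_copies (r : nat) (G : graph) : graph :=
  iterop r disjoint_union G (edgeless_graph 0).

Definition join_copies (r : nat) (G : graph) : graph :=
  iterop r graph_join G (edgeless_graph 0).

(* Main.v *)
Require Import Defs.
From mathcomp Require Import all_boot all_algebra.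
From mathcomp Require Import perm mpoly.

(** Every proper minor of [f] lies below a minor obtained by identifying two
    essential variables, so [f] is join-irreducible iff one of these
    identification minors, say of [i] and [j], is above all the others.  In the
    function of a graph, identifying [k] and [l] yields a vertex adjacent to the
    symmetric difference of their neighbourhoods, with a loop iff [kl] is an
    edge; besides [l], a variable becomes inessential only if [k] and [l] are
    twins, or if it is an apex, a vertex with neighbourhood exactly [{k, l}].

    Since comparable minors of equal essential arity are equivalent, an edge and
    a non-edge never give minors of equal arity.  If [ij] is a non-edge, then
    every edge has an apex, and the graph is a disjoint union of triangles.  If
    [ij] is an edge, then every non-edge consists of twins or has an apex, and
    the graph is [C_5] or complete multipartite.  In the latter case, an edge
    with an apex gives parts of sizes 1, 1, m; otherwise all edges give
    equivalent minors, and comparing the degrees of their loops shows that the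
    sum of the sizes of two distinct parts is constant.

    Conversely, if [x] is inessential after identifying [k] and [l], then this
    minor is below the one identifying [x] with any [y] distinct from [l];
    together with automorphisms this yields a largest minor for every listed
    graph. *)

Set Implicit Arguments.
Unset Strict Implicit.
Unset Printing Implicit Defensive.

Import GRing.Theory.

(** * Identification minors *)

Section Minors.
Local Open Scope ring_scope.

Definition pullback m n (s : 'I_n -> 'I_m) (a : {ffun 'I_m -> 'F_2}) :
  {ffun 'I_n -> 'F_2} := [ffun i => a (s i)].

Definition delta n (x : 'I_n) : {ffun 'I_n -> 'F_2} := [ffun y => (y == x)%:R].

Definition glue n (k l x : 'I_n) := if x == l then k else x.

(** The arity stays [n], and for [k != l] the variable [l] merely becomes inessential, so the
    variables of the minor and of [f] can be compared directly. *)
Definition identify n (f : boolfun n) (k l : 'I_n) : boolfun n :=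
  fun a => f (pullback (glue k l) a).

(** Over ['F_2], adding [delta x] flips coordinate [x]. *)
Definition ess n (f : boolfun n) : {set 'I_n} :=
  [set x | [exists a : {ffun 'I_n -> 'F_2}, f (a + delta x) != f a]].

Lemma F2_addr_neq (t u : 'F_2) : t != u -> t + 1 = u.
Proof.
by case: t u => [[|[|?]] ?] // [[|[|?]] ?] // _; apply: val_inj.
Qed.

Lemma F2_addrr (t : 'F_2) : t + t = 0.
Proof. by case: t => [[|[|?]] ?] //; apply: val_inj. Qed.

Lemma F2_boolD (b c : bool) : b%:R + c%:R = (b (+) c)%:R :> 'F_2.
Proof. by case: b c => [] [] //; apply: val_inj. Qed.

Lemma F2_bool_inj : injective (fun b : bool => b%:R : 'F_2).
Proof. by case=> [] []. Qed.

Lemma pullbackD m n (s : 'I_n -> 'I_m) a b :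
  pullback s (a + b) = pullback s a + pullback s b.
Proof. by apply/ffunP => i; rewrite !ffunE. Qed.

Lemma pullback0 m n (s : 'I_n -> 'I_m) : pullback s 0 = 0.
Proof. by apply/ffunP => i; rewrite !ffunE. Qed.

Lemma pullback_comp m n p (s : 'I_n -> 'I_m) (t : 'I_p -> 'I_n) a :
  pullback t (pullback s a) = pullback (s \o t) a.
Proof. by apply/ffunP => i; rewrite !ffunE. Qed.

Lemma minor_le_trans m n p (f : boolfun m) (g : boolfun n) (h : boolfun p) :
  minor_le f g -> minor_le g h -> minor_le f h.
Proof.
move=> [s fg] [t gh]; exists (s \o t) => a.
by rewrite fg gh; congr h; exact: pullback_comp.
Qed.

Lemma essPn n (f : boolfun n) x a : x \notin ess f -> f (a + delta x) = f a.
Proof. by rewrite inE negb_exists => /forallP/(_ a); rewrite negbK => /eqP. Qed.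

(** The coordinates where [a] and [b] differ are inessential and can be flipped one at a time; the
    induction is on their number. *)
Lemma eq_on_ess n (f : boolfun n) (a b : {ffun 'I_n -> 'F_2}) :
  {in ess f, a =1 b} -> f a = f b.
Proof.
have [N] := ubnP #|[set x | a x != b x]|.
elim: N a => // N IHN a; rewrite ltnS => leN eq_ab.
have [/eqP|[x]] := set_0Vmem [set x | a x != b x].
  rewrite -subset0 => /subsetP D0; congr f; apply/ffunP => x; apply/eqP.
  by apply: contraT => abx; move: (D0 x); rewrite !inE abx => /(_ isT).
rewrite inE => abx.
have xNess : x \notin ess f by apply: contra abx => /eq_ab ->.
rewrite -(essPn a xNess).
have ax : (a + delta x) x = b x by rewrite !ffunE eqxx; exact: F2_addr_neq.
have ay y : y != x -> (a + delta x) y = a y.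
  by move=> /negPf yx; rewrite !ffunE yx addr0.
apply: IHN => [|y /eq_ab aby]; last first.
  by case: (y =P x) => [->|/eqP yx]; rewrite ?ax ?ay.
apply: leq_trans leN; apply: proper_card; apply/properP; split.
  apply/subsetP => y; rewrite !in_set.
  by case: (y =P x) => [->|/eqP yx]; rewrite ?ax ?eqxx ?ay.
by exists x; rewrite !in_set ?ax ?eqxx.
Qed.

Lemma ess_minor_sub m n (g : boolfun m) (f : boolfun n) s :
  (forall a, g a = f (pullback s a)) -> ess g \subset s @: ess f.
Proof.
move=> gf; apply/subsetP => y; rewrite inE => /existsP[a]; apply: contraR => yN.
rewrite !gf; apply/eqP/eq_on_ess => x xf; rewrite !ffunE.
by case: eqP => [sxy|]; rewrite ?addr0 //; rewrite -sxy imset_f in yN.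
Qed.

(** In general [#|ess g|] is at most [#|s @: ess f|], which is at most [#|ess f|]; the hypothesis
    turns both bounds into equalities. *)
Lemma minor_ess_iso m n (g : boolfun m) (f : boolfun n) s :
  (forall a, g a = f (pullback s a)) -> (#|ess f| <= #|ess g|)%N ->
  {in ess f &, injective s} /\ s @: ess f = ess g.
Proof.
move=> /ess_minor_sub sub le_fg; have := subset_leq_card sub.
have le_img := leq_imset_card s (ess f) => le_g.
split; first by apply/imset_injP; rewrite eqn_leq le_img (leq_trans le_fg).
by apply/esym/eqP; rewrite eqEcard sub (leq_trans le_img).
Qed.

Lemma ess_identify_sub n (f : boolfun n) k l :
  k \in ess f -> k != l -> ess (identify f k l) \subset ess f :\ l.
Proof.
move=> kf kl; apply: (subset_trans (ess_minor_sub (fun=> erefl))).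
apply/subsetP => y /imsetP[x xf ->]; rewrite in_setD1 /glue.
by case: (x =P l) => [_|/eqP xl]; apply/andP.
Qed.

(** If [s] is injective on [ess f], it can be inverted there and [f] lies below [g]. Otherwise [s]
    merges two essential variables [k] and [l], hence factors through [glue k l]. *)
Lemma minor_lt_identify m n (g : boolfun m) (f : boolfun n) : (0 < n)%N ->
  minor_lt g f ->
  exists k l, [/\ k \in ess f, l \in ess f, k != l
                & minor_le g (identify f k l)].
Proof.
case: n f => // n f _ [[s gf] nfg].
have [inj_s|] := boolP (dinjectiveb s (mem (ess f))).
  (* The witness is a left inverse of [s] on [ess f]; the default [ord0] is taken only outside the
     image of [ess f]. *)
  case: nfg; exists (fun y => odflt ord0 [pick x in ess f | s x == y]) => a.
  rewrite gf; apply: eq_on_ess => x xf; rewrite !ffunE.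
  case: pickP => [y /andP[yf /eqP sy]|/(_ x)].
    by rewrite (dinjectiveP _ _ inj_s _ _ yf xf sy).
  by rewrite xf eqxx.
case/dinjectivePn => k kf [l /andP[lk lf] skl].
exists k, l; split; [by []|exact: lf|by rewrite eq_sym|].
exists s => a; rewrite gf; congr f; apply/ffunP => i; rewrite !ffunE /glue.
by case: eqP => [->|]; rewrite ?skl.
Qed.

(** Strictness comes from counting: [l] is no longer essential, and a minor never has more essential
    variables than the function above it. *)
Lemma identify_lt n (f : boolfun n) k l :
  k \in ess f -> l \in ess f -> k != l -> minor_lt (identify f k l) f.
Proof.
move=> kf lf kl; split; first by exists (glue k l).
move=> [s /ess_minor_sub/subset_leq_card].
move=> /leq_trans/(_ (leq_imset_card _ _)); apply/negP; rewrite -ltnNge.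
apply: leq_ltn_trans (subset_leq_card (ess_identify_sub kf kl)) _.
by rewrite [X in (_ < X)%N](cardsD1 l) lf.
Qed.

(** The largest proper minor [f'] itself lies below some identification minor, which inherits its
    maximality. *)
Lemma join_irreducibleP n (f : boolfun n) : (0 < n)%N ->
  join_irreducible f <->
  exists i j, [/\ i \in ess f, j \in ess f, i != j &
    forall k l, k \in ess f -> l \in ess f -> k != l ->
      minor_le (identify f k l) (identify f i j)].
Proof.
move=> n0; split=> [[m [f' [m0 f'f maxf']]]|[i [j [fi fj ij maxij]]]].
  have [i [j [fi fj ij f'ij]]] := minor_lt_identify n0 f'f.
  exists i, j; split=> // k l kf lf kl; apply: minor_le_trans f'ij.
  exact/maxf'/identify_lt.
exists n, (identify f i j); split=> //; first exact: identify_lt.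
move=> k g k0 /(minor_lt_identify n0) [u [v [fu fv uv guv]]].
exact: minor_le_trans guv (maxij _ _ _ _ _).
Qed.

Lemma identify_sym n (f : boolfun n) k l :
  minor_le (identify f k l) (identify f l k).
Proof.
exists (fun x => if x == k then l else if x == l then k else x) => a.
congr f; apply/ffunP => x; rewrite !ffunE /glue; congr (a _).
by do ![case: eqP => //] => *; congruence.
Qed.

(* As [x] is inessential in [identify f k l], it may be identified with [y]
   there for free, and the two identifications commute. *)
Lemma identify_iness n (f : boolfun n) k l x y :
  x \notin ess (identify f k l) -> x != l -> y != l -> x != y ->
  minor_le (identify f k l) (identify f x y).
Proof.
move=> xN xl yl xy; apply: minor_le_trans (identify_sym f y x).
exists (glue y x \o glue k l) => a.
transitivity (identify f k l (pullback (glue y x) a)).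
  apply: eq_on_ess => z zf; rewrite !ffunE /glue.
  by case: eqP => // zx; rewrite zx (negPf xN) in zf.
rewrite /identify; congr f; apply/ffunP => z; rewrite !ffunE /glue /=.
congr (a _); case: (z =P x) => [->|zx]; last by [].
by rewrite (negPf xl) (negPf yl) eqxx [y == x]eq_sym (negPf xy).
Qed.

(** Conjugating [glue k l] by [p] gives [glue (p k) (p l)], and [f] absorbs [p]. *)
Lemma identify_aut n (f : boolfun n) (p : 'I_n -> 'I_n) k l :
  bijective p -> (forall a, f (pullback p a) = f a) ->
  minor_le (identify f k l) (identify f (p k) (p l)).
Proof.
move=> [q pK qK] fp; exists q => a; rewrite /identify.
rewrite -[RHS]fp; congr f; apply/ffunP => x; rewrite !ffunE /glue.
by rewrite (can_eq pK); case: eqP; rewrite pK.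
Qed.

Lemma minor_iso_delta m n (g : boolfun m) (f : boolfun n) s x :
  (forall a, g a = f (pullback s a)) -> {in ess f &, injective s} ->
  x \in ess f -> g (delta (s x)) = f (delta x).
Proof.
move=> gf injs xf; rewrite gf; apply: eq_on_ess => z zf; rewrite !ffunE.
by rewrite (inj_in_eq injs).
Qed.

Lemma minor_iso_delta2 m n (g : boolfun m) (f : boolfun n) s x y :
  (forall a, g a = f (pullback s a)) -> {in ess f &, injective s} ->
  x \in ess f -> y \in ess f ->
  g (delta (s x) + delta (s y)) = f (delta x + delta y).
Proof.
move=> gf injs xf yf; rewrite gf; apply: eq_on_ess => z zf; rewrite !ffunE.
by rewrite !(inj_in_eq injs).
Qed.

(** When [f 0 = 0] this is the second difference of [f] at 0, like the bilinear form of a quadratic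
    form. It is preserved by renaming variables and recovers adjacency in minors. *)
Definition polar n (f : boolfun n) x y : 'F_2 :=
  f (delta x + delta y) + f (delta x) + f (delta y).

Lemma polar_ess n (f : boolfun n) x y :
  f 0 = 0 -> polar f x y != 0 -> y \in ess f.
Proof.
move=> f0; apply: contraR => yN; rewrite /polar (essPn _ yN) F2_addrr add0r.
by rewrite -[delta y]add0r (essPn _ yN) f0.
Qed.

(** By [polar_ess] only essential [y] are counted, and [s] maps these bijectively, preserving
    [polar]. *)
Lemma card_polar_iso m n (g : boolfun m) (f : boolfun n) s x :
  (forall a, g a = f (pullback s a)) -> {in ess f &, injective s} ->
  s @: ess f = ess g -> f 0 = 0 -> x \in ess f ->
  #|[set y | polar g (s x) y != 0]| = #|[set y | polar f x y != 0]|.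
Proof.
move=> gf injs im f0 xf.
have g0 : g 0 = 0 by rewrite gf pullback0.
have polE y : y \in ess f -> polar g (s x) (s y) = polar f x y.
  move=> yf; rewrite /polar (minor_iso_delta2 gf) //.
  by rewrite !(minor_iso_delta gf).
rewrite -(@card_in_imset _ _ s [set y | polar f x y != 0]).
  apply: eq_card => y; apply/idP/imsetP.
    rewrite inE => gy; have: y \in s @: ess f by rewrite im (polar_ess g0 gy).
    case/imsetP => z zf yE; exists z => //; rewrite inE -polE //.
    by rewrite -yE.
  by case=> z; rewrite inE => fz ->; rewrite inE polE // (polar_ess f0 fz).
by move=> y z; rewrite !inE => /(polar_ess f0) yf /(polar_ess f0) zf; apply: injs.
Qed.

End Minors.

(** * Adjacency *)

Section Adjacency.
Variable G : graph.
Implicit Types x y k l : G.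

Definition adj x y := [set x; y] \in edges G.

Definition apex x k l := forall y, adj x y = (y == k) || (y == l).

Definition twins k l := adj k l = false /\ forall y, adj k y = adj l y.

Definition non_isolated_set : {set G} := [set x | [exists y, adj x y]].

(** When [kl] is an edge, these are the neighbours of the looped vertex that arises from identifying
    [k] and [l]. *)
Definition skew_nbrs k l : {set G} :=
  [set x | [&& x != k, x != l & adj k x != adj l x]].

Lemma adj_sym x y : adj x y = adj y x.
Proof. by rewrite /adj setUC. Qed.

Lemma adj_irr x : adj x x = false.
Proof.
by apply/negP => /edges_loopless; rewrite setUid cards1.
Qed.

Lemma adj_neq x y : adj x y -> x != y.
Proof. by case: eqP => // ->; rewrite adj_irr. Qed.

Lemma non_isolatedP x : reflect (exists y, adj x y) (x \in non_isolated_set).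
Proof. by rewrite inE; exact: existsP. Qed.

Lemma adj_non_isolated x y : adj x y -> x \in non_isolated_set.
Proof. by move=> xy; apply/non_isolatedP; exists y. Qed.

Lemma non_isolatedE x : (x \in non_isolated_set) = [exists e in edges G, x \in e].
Proof.
apply/non_isolatedP/exists_inP => [[y xy]|[e eG xe]].
  by exists [set x; y] => //; rewrite !inE eqxx.
have /eqP/cards2P[u [v [_ eE]]] := edges_loopless eG.
move: xe eG; rewrite eE !inE => /orP[] /eqP->; first by exists v.
by rewrite setUC; exists u.
Qed.

Lemma apex_neq x k l : apex x k l -> (x != k) * (x != l).
Proof.
by move=> xkl; split; apply: adj_neq; rewrite xkl eqxx ?orbT.
Qed.

End Adjacency.

(** * The function of a graph and its identification minors *)

Section EdgeFunction.
Local Open Scope ring_scope.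
Variables (n : nat) (E : {set {set 'I_n}}) (E_loopless : loopless_edges E).
Let G := Graph E_loopless.
Local Notation adj := (@adj G).
Local Notation S := (non_isolated_set G).
Local Notation f := (edge_fun E).
Implicit Types x y z i j k l : 'I_n.

Definition nbr_sum (x : 'I_n) (a : {ffun 'I_n -> 'F_2}) : 'F_2 :=
  \sum_(y | adj x y) a y.

Lemma edge_funE a : f a = \sum_(e in E) \prod_(i in e) a i.
Proof.
rewrite /edge_fun /edge_poly raddf_sum; apply: eq_bigr => e _ /=.
by rewrite rmorph_prod; apply: eq_bigr => i _ /=; rewrite mevalXU.
Qed.

Lemma edge_fun0 : f 0 = 0.
Proof.
rewrite edge_funE big1 // => e eE.
have /eqP/cards2P[u [v [_ ->]]] := E_loopless eE.
by rewrite (bigD1 u) ?inE ?eqxx //= ffunE mul0r.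
Qed.

(** Flipping [x] affects only the monomials of edges at [x], and each such edge [xy] contributes the
    change [a y]. Thus [nbr_sum x] is the derivative of [f] in direction [x]. *)
Lemma edge_funD a x : f (a + delta x) = f a + nbr_sum x a.
Proof.
rewrite !edge_funE (bigID (fun e : {set 'I_n} => x \in e)) /=.
rewrite [X in _ = X + _](bigID (fun e : {set 'I_n} => x \in e)) /=.
rewrite [RHS]addrAC; congr (_ + _); last first.
  apply: eq_bigr => e /andP[_ xe]; apply: eq_bigr => i ie.
  rewrite !ffunE; case: eqP => [ix|]; rewrite ?addr0 //.
  by rewrite ix (negPf xe) in ie.
(* Edges at [x] correspond to neighbours of [x], which turns the sum over edges into a sum over
   vertices. *)
have imE : [set e in E | x \in e] = (fun y => [set x; y]) @: [set y | adj x y].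
  apply/setP => e; rewrite inE; apply/andP/imsetP => [[eE xe]|[y]]; last first.
    by rewrite inE => xy ->; split=> //; rewrite !inE eqxx.
  have /eqP/cards2P[u [v [_ eq_e]]] := E_loopless eE.
  move: xe eE; rewrite eq_e !inE => /orP[] /eqP-> eE.
    by exists v; rewrite ?inE.
  by exists u; [rewrite inE adj_sym | rewrite setUC].
have injE : {in [set y | adj x y] &, injective (fun y => [set x; y])}.
  move=> y z; rewrite !inE => xy _ /setP/(_ y); rewrite !inE eqxx orbT.
  by rewrite [y == x]eq_sym (negPf (adj_neq xy)) => /esym/eqP.
have sumE b : \sum_(e in E | x \in e) \prod_(i in e) b i =
    \sum_(y | adj x y) (b x * b y : 'F_2).
  rewrite (eq_bigl (fun e => e \in [set e in E | x \in e])) => [|e]; last by rewrite inE.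
  rewrite imE big_imset //=; apply: eq_big => [y|y]; first by rewrite inE.
  by rewrite inE => /adj_neq xy; rewrite big_setU1 ?inE //= big_set1.
rewrite !sumE -big_split; apply: eq_bigr => y /= xy; rewrite !ffunE eqxx.
by rewrite [y == x]eq_sym (negPf (adj_neq xy)) addr0 mulrDl mul1r.
Qed.

Lemma nbr_sumD x a b : nbr_sum x (a + b) = nbr_sum x a + nbr_sum x b.
Proof. by rewrite -big_split; apply: eq_bigr => y _; rewrite ffunE. Qed.

Lemma nbr_sum0 x : nbr_sum x 0 = 0.
Proof. by apply: big1 => y _; rewrite ffunE. Qed.

Lemma nbr_sum_delta x y : nbr_sum x (delta y) = (adj x y)%:R.
Proof.
rewrite /nbr_sum big_mkcond (bigD1 y) //= big1 => [|z /negPf zy].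
  by rewrite ffunE eqxx addr0; case: (adj x y).
by rewrite ffunE zy; case: ifP.
Qed.

Lemma edge_fun_delta x : f (delta x) = 0.
Proof. by rewrite -[delta x]add0r edge_funD edge_fun0 nbr_sum0 addr0. Qed.

Lemma edge_fun_delta2 x y : f (delta x + delta y) = (adj x y)%:R.
Proof.
by rewrite edge_funD edge_fun_delta add0r nbr_sum_delta adj_sym.
Qed.

Lemma ess_edge_fun : ess f = S.
Proof.
apply/setP => x; apply/idP/idP.
  rewrite inE => /existsP[a]; apply: contraR; rewrite inE negb_exists.
  move=> /forallP xN; rewrite edge_funD /nbr_sum big1 ?addr0 // => y.
  by rewrite (negPf (xN y)).
move=> xS; have [y xy] := @non_isolatedP G x xS; rewrite inE; apply/existsP; exists (delta y).
by rewrite edge_fun_delta2 edge_fun_delta adj_sym xy oner_neq0.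
Qed.

Lemma pullback_glue_delta k l x :
  x != k -> x != l -> pullback (glue k l) (delta x) = delta x.
Proof.
move=> xk xl; apply/ffunP => y; rewrite !ffunE /glue.
case: (y =P l) => [->|//]; rewrite [k == x]eq_sym [l == x]eq_sym.
by rewrite (negPf xk) (negPf xl).
Qed.

Lemma pullback_glue_deltal k l :
  k != l -> pullback (glue k l) (delta k) = delta k + delta l.
Proof.
move=> kl; apply/ffunP => y; rewrite !ffunE /glue.
case: (y =P l) => [->|]; first by rewrite eqxx [l == k]eq_sym (negPf kl) add0r.
by rewrite addr0.
Qed.

Lemma pullback_glue_deltar k l :
  k != l -> pullback (glue k l) (delta l) = 0.
Proof.
move=> kl; apply/ffunP => y; rewrite !ffunE /glue.
by case: (y =P l) => [_|/eqP/negPf->//]; rewrite (negPf kl).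
Qed.

Lemma identify0 k l : identify f k l 0 = 0.
Proof. by rewrite /identify pullback0 edge_fun0. Qed.

Lemma identify_delta k l x : k != l ->
  identify f k l (delta x) = ((x == k) && adj k l)%:R.
Proof.
move=> kl; rewrite /identify; case: (x =P k) => [->|/eqP xk].
  by rewrite pullback_glue_deltal // edge_fun_delta2.
case: (x =P l) => [->|/eqP xl].
  by rewrite pullback_glue_deltar // edge_fun0.
by rewrite pullback_glue_delta // edge_fun_delta.
Qed.

Lemma identify_delta2 k l x : k != l -> x != k -> x != l ->
  identify f k l (delta k + delta x) =
    (adj k l)%:R + ((adj k x)%:R + (adj l x)%:R).
Proof.
move=> kl xk xl; rewrite /identify pullbackD pullback_glue_deltal //.
rewrite pullback_glue_delta // edge_funD edge_fun_delta2 nbr_sumD.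
by rewrite !nbr_sum_delta ![adj x _]adj_sym.
Qed.

(** Identifying the ends of an edge turns its monomial into the linear term of [k], a loop; the
    quadratic terms at [k] that survive come from vertices adjacent to exactly one of [k] and
    [l]. *)
Lemma polar_identify k l x : k != l -> adj k l ->
  polar (identify f k l) k x =
    [&& x != k, x != l & adj k x != adj l x]%:R.
Proof.
move=> kl akl; rewrite /polar !identify_delta // akl eqxx.
case: (x =P k) => [->|/eqP xk].
  rewrite (_ : delta k + delta k = 0) ?identify0 ?add0r ?F2_addrr //.
  by apply/ffunP => y; rewrite !ffunE F2_addrr.
case: (x =P l) => [->|/eqP xl].
  rewrite /identify pullbackD pullback_glue_deltal ?pullback_glue_deltar //.
  by rewrite !addr0 edge_fun_delta2 akl F2_addrr.
rewrite identify_delta2 // akl addr0 addrAC F2_addrr add0r F2_boolD /=.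
by case: (adj k x) (adj l x) => [] [].
Qed.

(** The derivative of the minor in direction [x] vanishes. Testing it at [delta z] excludes
    neighbours other than [k] and [l]; testing it at [delta k] shows that [x] is adjacent to both or
    to neither. *)
Lemma iness_identify_apex k l x : k != l -> x \in S -> x != k -> x != l ->
  x \notin ess (identify f k l) -> apex (x : G) k l.
Proof.
move=> kl /non_isolatedP[y xy] xk xl xN.
have idN a : nbr_sum x (pullback (glue k l) a) = 0.
  have := essPn a xN; rewrite /identify pullbackD pullback_glue_delta //.
  by rewrite edge_funD -[RHS]addr0 => /addrI.
have xz z : z != k -> z != l -> adj x z = false.
  move=> zk zl; have := idN (delta z).
  by rewrite pullback_glue_delta // nbr_sum_delta; case: (adj x z).
have := idN (delta k); rewrite pullback_glue_deltal // nbr_sumD.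
rewrite !nbr_sum_delta F2_boolD => /(@F2_bool_inj _ false) xkl.
move: (xkl); case: (y =P k) xy => [->|/eqP yk] xy.
  rewrite xy => /= /negbFE xl1 z; case: (z =P k) => [->//|/eqP zk].
  by case: (z =P l) => [->//|/eqP zl]; exact: xz.
case: (y =P l) xy => [->|/eqP yl] xy; last by rewrite xz in xy.
rewrite xy addbT => /negbFE xk1 z; case: (z =P k) => [->//|/eqP zk].
by case: (z =P l) => [->//|/eqP zl]; exact: xz.
Qed.

(** The two neighbours of [x] receive the same value, so the derivative in direction [x] cancels. *)
Lemma apex_iness_identify k l x : k != l ->
  apex (x : G) k l -> x \notin ess (identify f k l).
Proof.
move=> kl xkl; have [xk xl] := apex_neq xkl.
rewrite inE negb_exists; apply/forallP => a; rewrite negbK; apply/eqP.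
rewrite /identify pullbackD pullback_glue_delta // edge_funD.
rewrite [nbr_sum _ _](_ : _ = 0) ?addr0 // /nbr_sum (bigD1 k) /=; last first.
  by rewrite xkl eqxx.
rewrite (bigD1 l) /= ?xkl ?eqxx ?orbT ?[l == k]eq_sym //.
rewrite big1 => [|y]; last first.
  by rewrite xkl -andbA => /and3P[/orP[]/eqP->]; rewrite eqxx ?andbF.
by rewrite !ffunE /glue eqxx (negPf kl) addr0 F2_addrr.
Qed.

(** Flipping [k] in the minor flips both [k] and [l] in [f]; the constant is the mixed term of the
    two flips. *)
Lemma identify_deltalD k l a : k != l ->
  identify f k l (a + delta k) = identify f k l a +
    (nbr_sum k (pullback (glue k l) a) + nbr_sum l (pullback (glue k l) a)
     + (adj k l)%:R).
Proof.
move=> kl; rewrite /identify pullbackD pullback_glue_deltal // addrA !edge_funD.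
by rewrite nbr_sumD nbr_sum_delta [adj l k]adj_sym !addrA.
Qed.

(** The change caused by flipping [k] is zero everywhere: at 0 this says that [kl] is a non-edge,
    and at [delta y] that [k] and [l] agree on [y]. *)
Lemma iness_identify_twins k l : k != l ->
  k \notin ess (identify f k l) -> twins (k : G) l.
Proof.
move=> kl kN.
have idN a : nbr_sum k (pullback (glue k l) a)
    + nbr_sum l (pullback (glue k l) a) + (adj k l)%:R = 0.
  by have := essPn a kN; rewrite identify_deltalD // -[RHS]addr0 => /addrI.
have akl : adj k l = false.
  have := idN 0; rewrite pullback0 !nbr_sum0 !add0r.
  exact: (@F2_bool_inj _ false).
split=> // y; case: (y =P k) => [->|/eqP yk].
  by rewrite adj_irr adj_sym akl.
case: (y =P l) => [->|/eqP yl]; first by rewrite adj_irr akl.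
have := idN (delta y); rewrite pullback_glue_delta // !nbr_sum_delta akl.
rewrite addr0 F2_boolD => /(@F2_bool_inj _ false).
by case: (adj k y) (adj l y) => [] [].
Qed.

Lemma twins_iness_identify k l : k != l ->
  twins (k : G) l -> k \notin ess (identify f k l).
Proof.
move=> kl [akl eqN]; rewrite inE negb_exists; apply/forallP => a.
rewrite negbK identify_deltalD // akl addr0 /nbr_sum.
by rewrite (eq_bigl _ _ eqN) F2_addrr addr0.
Qed.

(** Every identification loses at least one essential variable, and this one loses only [l]. *)
Lemma card_ess_identify k l : k \in S -> l \in S -> k != l ->
  (forall x, x \in S -> x != l -> x \in ess (identify f k l)) ->
  forall i j, i \in S -> j \in S -> i != j ->
  (#|ess (identify f i j)| <= #|ess (identify f k l)|)%N.
Proof.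
move=> kS lS kl full i j iS jS ij.
have /subset_leq_card/leq_trans : ess (identify f i j) \subset S :\ j.
  by rewrite -ess_edge_fun; apply: ess_identify_sub; rewrite ?ess_edge_fun.
apply; have [cj cl] := (cardsD1 j S, cardsD1 l S).
rewrite jS in cj; rewrite lS in cl.
have -> : #|S :\ j| = #|S :\ l| by apply/eqP; rewrite -(eqn_add2l true) -cj -cl.
by apply/subset_leq_card/subsetP => x /setD1P[xl xS]; apply: full.
Qed.

(* When no further variable becomes inessential, the two minors have the same
   essential arity, hence are equivalent: loops and their degrees agree. *)
Lemma minor_identify_full i j k l :
  i \in S -> j \in S -> i != j -> k \in S -> l \in S -> k != l ->
  minor_le (identify f k l) (identify f i j) ->
  (forall x, x \in S -> x != l -> x \in ess (identify f k l)) ->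
  (adj k l = adj i j) /\ (adj i j -> #|@skew_nbrs G k l| = #|@skew_nbrs G i j|).
Proof.
move=> iS jS ij kS lS kl [s gf] full.
have [injs im] := minor_ess_iso gf (card_ess_identify kS lS kl full iS jS ij).
(* Values at unit vectors detect loops, so [s] must match the loops of the two minors. *)
have delE x : x \in ess (identify f i j) ->
    (s x == k) && adj k l = (x == i) && adj i j.
  move=> xS; apply: F2_bool_inj; rewrite /= -!identify_delta //.
  exact: minor_iso_delta gf injs xS.
have si : adj i j -> i \in ess (identify f i j).
  move=> aij; rewrite inE; apply/existsP; exists 0.
  by rewrite add0r identify0 identify_delta // eqxx aij oner_neq0.
have aE : adj k l = adj i j.
  apply/idP/idP => [akl|/[dup] aij /si /delE]; last first.
    by rewrite aij eqxx /= => /andP[].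
  have: k \in s @: ess (identify f i j) by rewrite im full.
  case/imsetP => x xS kE; have := delE x xS.
  by rewrite -kE eqxx akl => /esym/andP[].
split=> // aij; have iE := si aij; have := delE _ iE.
rewrite aE aij eqxx andbT => /eqP sik.
have := card_polar_iso gf injs im (identify0 i j) iE; rewrite sik.
have boolE (b : bool) : (b%:R != 0 :> 'F_2) = b by case: b.
have -> : [set y | polar (identify f k l) k y != 0] =
    @skew_nbrs G k l.
  by apply/setP => x; rewrite !inE polar_identify ?aE // boolE.
move->; apply: eq_card => x; rewrite !inE polar_identify // boolE //.
Qed.

(** Either some [x] other than [l] also becomes inessential, which means twins if [x = k] and an
    apex otherwise, or [minor_identify_full] applies. *)
Lemma minor_identify_dichotomy i j k l :
  i \in S -> j \in S -> i != j -> k \in S -> l \in S -> k != l ->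
  minor_le (identify f k l) (identify f i j) ->
  [\/ twins (k : G) l, exists x : G, apex x k l |
     (adj k l = adj i j) /\ (adj i j -> #|@skew_nbrs G k l| = #|@skew_nbrs G i j|)].
Proof.
move=> iS jS ij kS lS kl le_kl.
have [/existsP[x /and3P[xS xl xN]]|] :=
  boolP [exists x, [&& x \in S, x != l & x \notin ess (identify f k l)]].
  case: (x =P k) xN => [-> /(iness_identify_twins kl)|/eqP xk xN].
    by constructor 1.
  by constructor 2; exists x; apply: iness_identify_apex.
rewrite negb_exists => /forallP full; constructor 3.
apply: minor_identify_full => // x xS xl.
by have := full x; rewrite xS xl negbK.
Qed.

End EdgeFunction.

(** * Isomorphisms and coloured graphs *)

Lemma mem_edges_imset (G H : graph) (phi : G -> H) (e : {set G}) :
  injective phi -> (forall x y, adj (phi x) (phi y) = adj x y) ->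
  (phi @: e \in edges H) = (e \in edges G).
Proof.
move=> inj_phi phiE.
have [/cards2P[x [y [_ ->]]]|e2] := boolP (#|e| == 2).
  by rewrite imsetU !imset_set1; exact: phiE.
have notE (K : graph) (d : {set K}) : #|d| != 2 -> (d \in edges K) = false.
  by apply: contraNF => /edges_loopless/eqP.
by rewrite !notE // card_imset.
Qed.

Lemma graph_isoP (G H : graph) :
  graph_iso G H <->
  exists2 phi : G -> H, bijective phi &
    forall x y, adj (phi x) (phi y) = adj x y.
Proof.
split=> -[phi bij_phi phiE]; exists phi => //.
  by move=> x y; rewrite /adj -phiE imsetU !imset_set1.
by move=> e; apply: mem_edges_imset; first exact: bij_inj.
Qed.

Lemma graph_iso_sym (G H : graph) : graph_iso G H -> graph_iso H G.
Proof.
case/graph_isoP => phi [psi phiK psiK] phiE; apply/graph_isoP.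
by exists psi => [|x y]; [exists phi | rewrite -phiE !psiK].
Qed.

(** Each element goes to the element at the same position in the enumeration of the equally coloured
    class. *)
Lemma colored_injection (T U : finType) (C : eqType) (c : T -> C) (d : U -> C) :
  (forall z, #|[set x | c x == z]| = #|[set y | d y == z]|) ->
  exists2 phi : T -> U, injective phi & forall x, d (phi x) = c x.
Proof.
move=> eq_cd; pose A z := enum [set x | c x == z]; pose B z := enum [set y | d y == z].
have sizeAB z : size (A z) = size (B z) by rewrite -!cardE.
have xA x : x \in A (c x) by rewrite mem_enum inE.
have idx x : index x (A (c x)) < size (B (c x)) by rewrite -sizeAB index_mem.
(* The index is in range, so the default of [nth] is immaterial; taking [y] as its own default
   avoids having to supply an element of [U]. *)
have witU x : exists y, y == nth y (B (c x)) (index x (A (c x))).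
  have := idx x; case: (B (c x)) => // y0 s lt_x.
  by exists (nth y0 (y0 :: s) (index x (A (c x)))); rewrite (set_nth_default y0).
pose phi x := xchoose (witU x).
have phiE x y0 : phi x = nth y0 (B (c x)) (index x (A (c x))).
  by rewrite [LHS](eqP (xchooseP (witU x))) (set_nth_default y0).
have phiB x : phi x \in B (c x) by rewrite (phiE x (phi x)) mem_nth.
have dphi x : d (phi x) = c x by have := phiB x; rewrite mem_enum inE => /eqP.
have inj_phi : injective phi.
  move=> x y eq_xy; have eq_c : c x = c y by rewrite -!dphi eq_xy.
  have := phiE x (phi x); rewrite {1}eq_xy (phiE y (phi x)) eq_c => /eqP.
  rewrite nth_uniq ?enum_uniq // -?eq_c // ?eq_c // => /eqP eq_i.
  have xA' : x \in A (c y) by rewrite -eq_c.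
  by rewrite -(nth_index x xA') -eq_i nth_index.
by exists phi.
Qed.

Lemma colored_bijection (T U : finType) (C : eqType) (c : T -> C) (d : U -> C) :
  (forall z, #|[set x | c x == z]| = #|[set y | d y == z]|) ->
  exists2 phi : T -> U, bijective phi & forall x, d (phi x) = c x.
Proof.
move=> eq_cd; have [phi inj_phi dphi] := colored_injection eq_cd.
have [psi inj_psi _] := colored_injection (fun z => esym (eq_cd z)).
by exists phi => //; apply: inj_card_bij => //; exact: leq_card inj_psi.
Qed.

(* For [b = false] this is the complete multipartite graph with [s z] vertices
   of colour [z], for [b = true] the disjoint union of the complete graphs on
   the colour classes. *)
Definition coloring (b : bool) (G : graph) (c : G -> nat) :=
  forall x y, adj x y = (x != y) && ((c x == c y) == b).

Definition colored (b : bool) (G : graph) (s : nat -> nat) :=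
  exists2 c : G -> nat, coloring b c & forall z, #|[set x | c x == z]| = s z.

(** Colours alone decide the adjacency of distinct vertices, so any colour-preserving bijection is
    an isomorphism. *)
Lemma colored_iso b (G H : graph) s :
  colored b G s -> colored b H s -> graph_iso G H.
Proof.
move=> [c cE cs] [d dE ds]; have [z|phi bij_phi dphi] := @colored_bijection _ _ _ c d.
  by rewrite cs ds.
apply/graph_isoP; exists phi => // x y.
by rewrite dE cE !dphi (inj_eq (bij_inj bij_phi)).
Qed.

Lemma eq_colored b (G : graph) s t : s =1 t -> colored b G s -> colored b G t.
Proof. by move=> st [c cE cs]; exists c => // z; rewrite cs st. Qed.

(** * Disjoint unions and joins of coloured graphs *)

Section Sums.
Variables G H : graph.

Lemma adj_disjoint_union (u v : disjoint_union G H) :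
  adj u v = match u, v with
            | inl x, inl y => adj x y
            | inr x, inr y => adj x y
            | _, _ => false
            end.
Proof.
have notl (x : G) (w : G + H) : [set w; inl x] \in
    [set inr @: (e : {set H}) | e in edges H] = false.
  apply/imsetP => -[e _] /setP/(_ (inl x)); rewrite !inE eqxx orbT.
  by move=> /esym/imsetP[].
have notr (x : H) (w : G + H) : [set w; inr x] \in
    [set inl @: (e : {set G}) | e in edges G] = false.
  apply/imsetP => -[e _] /setP/(_ (inr x)); rewrite !inE eqxx orbT.
  by move=> /esym/imsetP[].
have imE (T : finType) (h : T -> G + H) x y : [set h x; h y] = h @: [set x; y].
  by rewrite imsetU !imset_set1.
rewrite {1}/adj /= inE; case: u v => [x|x] [y|y].
- by rewrite notl orbF imE mem_imset //; apply/imset_inj/inl_inj.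
- by rewrite notr setUC notl.
- by rewrite notl setUC notr.
- by rewrite notr /= imE mem_imset //; apply/imset_inj/inr_inj.
Qed.

Lemma adj_graph_join (u v : graph_join G H) :
  adj u v = match u, v with
            | inl x, inl y => adj x y
            | inr x, inr y => adj x y
            | _, _ => true
            end.
Proof.
have crossE (x : G) (y : H) :
    [set inl x; inr y] \in [set [set inl x; inr y] | x in [set: G], y in [set: H]].
  by apply/imset2P; exists x y; rewrite ?inE.
rewrite {1}/adj /= inE -[X in X || _]/(adj (u : disjoint_union G H) v).
rewrite adj_disjoint_union; case: u v => [x|x] [y|y] /=; rewrite ?crossE //.
- case: imset2P => [[x' y' _ _] /setP/(_ (inr y'))|]; last by rewrite orbF.
  by rewrite !inE eqxx orbT.
- by rewrite setUC crossE.
case: imset2P => [[x' y' _ _] /setP/(_ (inl x'))|]; last by rewrite orbF.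
by rewrite !inE eqxx.
Qed.

End Sums.

Lemma color_lt (T : finType) (c : T -> nat) s p x :
  (forall z, #|[set x | c x == z]| = s z) -> (forall z, p <= z -> s z = 0) -> c x < p.
Proof.
move=> cs s0; rewrite ltnNge; apply/negP => /s0; rewrite -cs.
by move/eqP; rewrite cards_eq0 => /eqP/setP/(_ x); rewrite !inE eqxx.
Qed.

Lemma card_set_sum (T U : finType) (A : {set T + U}) :
  #|A| = #|[set x | inl x \in A]| + #|[set y | inr y \in A]|.
Proof.
rewrite -(card_imset _ (@inl_inj T U)) -(card_imset [set y | _] (@inr_inj T U)).
rewrite -cardsUI (_ : _ :&: _ = set0) ?cards0 ?addn0; last first.
  by apply/setP => u; rewrite !inE; apply/andP => -[/imsetP[x _ ->] /imsetP[]].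
apply: eq_card => -[x|x]; rewrite !inE.
  rewrite mem_imset ?inE; last exact: inl_inj.
  by case: imsetP => [[]|]; rewrite ?orbF.
rewrite orbC mem_imset ?inE; last exact: inr_inj.
by case: imsetP => [[]|]; rewrite ?orbF.
Qed.

(** The colours of [G] lie below [p] and those of [H] are shifted by [p], so colours never agree
    across the two sides: for [b = true] this means no cross edges, for [b = false] all of them. *)
Lemma colored_sum b (G H : graph) s t p :
  (forall z, p <= z -> s z = 0) -> colored b G s -> colored b H t ->
  colored b (if b then disjoint_union G H else graph_join G H)
    (fun z => if z < p then s z else t (z - p)).
Proof.
move=> s0 [c cE cs] [d dE ds].
have c_lt x : c x < p by apply: color_lt s0.
have cd x y : (c x == p + d y) = false by apply: ltn_eqF; rewrite ltn_addr.
pose k (u : G + H) := match u with inl x => c x | inr y => p + d y end.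
have kE z : #|[set u | k u == z]| = if z < p then s z else t (z - p).
  rewrite card_set_sum; case: ltnP => zp.
    rewrite [X in _ + X](_ : _ = 0) ?addn0 -?cs.
      by apply: eq_card => x; rewrite !inE.
    apply: eq_card0 => y; rewrite !inE /=; apply: gtn_eqF.
    by rewrite (leq_trans zp) ?leq_addr.
  rewrite [X in X + _](_ : _ = 0) ?add0n -?ds.
    by apply: eq_card => y; rewrite !inE /= -{1}(subnKC zp) eqn_add2l.
  apply: eq_card0 => x; rewrite !inE /=; apply: ltn_eqF.
  exact: leq_trans (c_lt x) zp.
have dc x y : (p + d y == c x) = false by rewrite eq_sym cd.
case: b cE dE => cE dE; exists k => // u v.
  rewrite adj_disjoint_union /k; case: u v => [x|x] [y|y].
  - by rewrite cE (inj_eq inl_inj).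
  - by rewrite cd.
  - by rewrite dc.
  - by rewrite dE eqn_add2l (inj_eq inr_inj).
rewrite adj_graph_join /k; case: u v => [x|x] [y|y].
- by rewrite cE (inj_eq inl_inj).
- by rewrite cd.
- by rewrite dc.
- by rewrite dE eqn_add2l (inj_eq inr_inj).
Qed.

Lemma colored_copies b (G : graph) k r : 0 < r ->
  colored b G (fun z => (z == 0) * k) ->
  colored b (if b then disjoint_copies r G else join_copies r G)
    (fun z => (z < r) * k).
Proof.
case: r => // r _ GE; elim: r => [|r IHr].
  by case: b GE => GE; apply: eq_colored GE => -[].
have := colored_sum (p := 1) _ GE IHr; case: b {GE IHr} => /= H.
  by apply: eq_colored (H _) => -[|z] //=; rewrite subn1.
by apply: eq_colored (H _) => -[|z] //=; rewrite subn1.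
Qed.

Lemma colored_edgeless k : colored false (edgeless_graph k) (fun z => (z == 0) * k).
Proof.
exists (fun=> 0) => [x y|[|z]]; first by rewrite /adj inE andbF.
  by rewrite mul1n -[RHS]card_ord; apply: eq_card => x; rewrite !inE.
by rewrite mul0n; apply: eq_card0 => x; rewrite !inE.
Qed.

Lemma adj_complete k (x y : complete_graph k) : adj x y = (x != y).
Proof. by rewrite /adj /= inE cards2; case: (x != y). Qed.

(** Complete graphs are treated as multipartite graphs with parts of size 1; the factor 1 gives the
    same shape as for [join_copies]. *)
Lemma colored_complete k : colored false (complete_graph k) (fun z => (z < k) * 1).
Proof.
exists (fun x : 'I_k => x : nat) => [x y|z].
  by rewrite adj_complete (inj_eq val_inj); case: eqP.
rewrite muln1; case: ltnP => [zk|kz].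
  transitivity #|[set Ordinal zk]|; last by rewrite cards1.
  apply: eq_card => x.
  by rewrite !inE -(inj_eq val_inj).
by apply: eq_card0 => x; rewrite !inE; apply: ltn_eqF; exact: leq_trans kz.
Qed.

Lemma colored_clique k : colored true (complete_graph k) (fun z => (z == 0) * k).
Proof.
exists (fun=> 0) => [x y|[|z]]; first by rewrite adj_complete andbT.
  by rewrite mul1n -[RHS]card_ord; apply: eq_card => x; rewrite !inE.
by rewrite mul0n; apply: eq_card0 => x; rewrite !inE.
Qed.

(** * A sufficient condition for join-irreducibility *)

Section Dominance.
Variable G : graph.
Implicit Types x y i j k l : G.

(** The pair may be reversed, because [identify f k l] and [identify f l k] lie below each other. *)
Definition pair_aut k l i j :=
  exists2 p : G -> G, bijective p /\ (forall x y, adj (p x) (p y) = adj x y) &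
    (p k = i /\ p l = j) \/ (p k = j /\ p l = i).

(* [x] becomes isolated when [k] and [l] are identified. *)
Definition isolates k l x := (x = k /\ twins k l) \/ apex x k l.

(* Either alternative makes the minor identifying [k] and [l] lie below the one
   identifying [i] and [j]. *)
Definition dominated :=
  exists i j, i != j /\ forall k l, k != l ->
    pair_aut k l i j \/
    exists x y, [/\ isolates k l x, x != y, y != l & pair_aut x y i j].

End Dominance.

Lemma dominated_iso (G H : graph) : graph_iso G H -> dominated H -> dominated G.
Proof.
case/graph_isoP => phi [psi phiK psiK] phiE [i [j [ij domij]]].
have psiE u v : adj (psi u) (psi v) = adj u v by rewrite -phiE !psiK.
have eqpsi u x : (u == phi x) = (psi u == x) by rewrite (can2_eq psiK phiK).
have autE k l : pair_aut (phi k) (phi l) i j -> pair_aut k l (psi i) (psi j).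
  case=> p [[q pK qK] pE] pij; exists (psi \o p \o phi) => /=.
    split=> [|x y]; last by rewrite psiE pE phiE.
    by exists (psi \o q \o phi) => x /=; rewrite psiK ?pK ?qK phiK.
  by case: pij => -[-> ->]; [left | right].
exists (psi i), (psi j); split; first by rewrite (can_eq psiK).
move=> k l kl; have [|autkl|[x [y [xkl xy yl autxy]]]] := domij (phi k) (phi l).
- by rewrite (can_eq phiK).
- by left; exact: autE.
right; exists (psi x), (psi y); split; first 1 last.
- by rewrite (can_eq psiK).
- by apply: contraNneq yl => <-; rewrite psiK.
- by apply: autE; rewrite !psiK.
case: xkl => [[-> [nkl eqN]]|xkl].
  left; rewrite phiK; split=> //; split=> [|z]; first by rewrite -phiE.
  by rewrite -!phiE eqN.
by right=> z; rewrite -phiE psiK xkl !(can_eq phiK).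
Qed.

Lemma adj_delete_isolated (G : graph) (u v : delete_isolated G) :
  adj u v = adj (val u) (val v).
Proof. by rewrite /adj /= inE imsetU !imset_set1. Qed.

Section DominatedFunction.
Local Open Scope ring_scope.
Variables (n : nat) (E : {set {set 'I_n}}) (E_loopless : loopless_edges E).
Let G := Graph E_loopless.
Local Notation S := (non_isolated_set G).
Local Notation f := (edge_fun E).

Lemma edge_fun_aut (p : G -> G) a : bijective p ->
  (forall x y, adj (p x) (p y) = adj x y) -> f (pullback p a) = f a.
Proof.
move=> bij_p pE; have inj_p := bij_inj bij_p.
have memE (e : {set 'I_n}) : (p @: e \in E) = (e \in E).
  exact: (@mem_edges_imset G G).
rewrite !edge_funE // [RHS](reindex_inj (imset_inj inj_p)) /=.
apply: eq_big => [e|e _]; first by rewrite memE.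
rewrite big_imset /=; last by move=> x y _ _; exact: inj_p.
by apply: eq_bigr => i _; rewrite ffunE.
Qed.

Lemma dominated_join_irreducible :
  (0 < n)%N -> dominated (delete_isolated G) -> join_irreducible f.
Proof.
move=> n0 [i [j [ij domij]]]; apply/join_irreducibleP => //.
have valS (u : delete_isolated G) : val u \in S by rewrite non_isolatedE (valP u).
have SubS x : x \in S -> exists u : delete_isolated G, x = val u.
  by rewrite non_isolatedE => xS; exists (Sub x xS).
have NS x y : x \notin S -> @adj G x y = false.
  by apply: contraNF; exact: adj_non_isolated.
(* Automorphisms of the graph without isolated vertices are extended by the identity. *)
pose ext (p : delete_isolated G -> delete_isolated G) (x : G) : G :=
  oapp (fun u => val (p u)) x (insub x).
have extv p u : ext p (val u) = val (p u) by rewrite /ext valK.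
have extN p x : x \notin S -> ext p x = x.
  by rewrite non_isolatedE => xS; rewrite /ext insubN.
have extK p q : cancel p q -> cancel (ext p) (ext q).
  move=> pK x; have [/SubS[u ->]|xS] := boolP (x \in S).
    by rewrite !extv pK.
  by rewrite !extN.
have autE k l : pair_aut k l i j ->
    minor_le (identify f (val k) (val l)) (identify f (val i) (val j)).
  case=> p [[q pK qK] pE] pij.
  have pE' (x y : G) : adj (ext p x) (ext p y) = adj x y.
    have [/SubS[u ->]|xS] := boolP (x \in S); last by rewrite (extN _ _ xS) !NS.
    have [/SubS[v ->]|yS] := boolP (y \in S).
      by rewrite !extv -!adj_delete_isolated.
    by rewrite (extN _ _ yS) adj_sym [RHS]adj_sym !NS.
  have bij_p : bijective (ext p) by exists (ext q); apply: extK.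
  have := identify_aut (val k) (val l) bij_p (fun a => edge_fun_aut a bij_p pE').
  rewrite !extv; case: pij => -[-> ->] // /minor_le_trans; apply.
  exact: identify_sym.
rewrite ess_edge_fun.
exists (val i), (val j); split; rewrite ?valS ?(inj_eq val_inj) //.
move=> _ _ /SubS[k ->] /SubS[l ->]; rewrite (inj_eq val_inj) => kl.
have kl' : val k != val l by rewrite (inj_eq val_inj).
have [/autE//|[x [y [xkl xy yl autxy]]]] := domij k l kl.
(* The minor of [k] and [l] lies below that of [x] and [y] by [identify_iness], and the latter below
   that of [i] and [j] by the automorphism. *)
apply: minor_le_trans (autE _ _ autxy).
have xl : x != l by case: xkl => [[-> _]//|/apex_neq[]].
apply: identify_iness; rewrite ?(inj_eq val_inj) //.
case: xkl => [[-> [nkl eqN]]|xkl].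
  apply: twins_iness_identify => //; split; first by rewrite -adj_delete_isolated.
  move=> z; have [/SubS[u ->]|zS] := boolP (z \in S).
    by rewrite -!adj_delete_isolated eqN.
  by rewrite ![adj _ z]adj_sym !NS.
apply: apex_iness_identify => // z; have [/SubS[u ->]|zS] := boolP (z \in S).
  by rewrite -adj_delete_isolated xkl !(inj_eq val_inj).
rewrite adj_sym NS //; apply/esym/negbTE; rewrite negb_or.
by apply/andP; split; apply: contraNneq zS => ->; exact: valS.
Qed.

End DominatedFunction.

Definition swap (p q z : nat) := if z == p then q else if z == q then p else z.

Lemma swapK p q : involutive (swap p q).
Proof. by move=> z; rewrite /swap; do ![case: eqP => //]; congruence. Qed.

(** * Automorphisms of coloured graphs *)

Section ColoredDominance.
Variables (b : bool) (G : graph) (c : G -> nat).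
Hypothesis cE : coloring b c.

Definition class_size x := #|[set y | c y == c x]|.

(** A permutation of the colours that respects class sizes lifts to an automorphism; transpositions
    within colour classes then adjust it to hit [i] and [j] exactly. *)
Lemma colored_pair_aut k l i j : c k != c l -> c i != c j ->
  class_size k = class_size i -> class_size l = class_size j -> pair_aut k l i j.
Proof.
move=> kl ij ski slj; pose s z := #|[set y | c y == z]|.
have swapS p q z : s p = s q -> s (swap p q z) = s z.
  rewrite /swap => spq; case: (z =P p) => [->|_]; first by rewrite spq.
  by case: (z =P q) => [->|_].
pose u := swap (c k) (c i) (c l).
have ski' : s (c k) = s (c i) by [].
have su : s u = s (c j) by rewrite swapS.
(* The first swap sends [c k] to [c i] and [c l] to [u]; the second sends [u] to [c j] and fixes
   [c i]. *)
pose t z := swap u (c j) (swap (c k) (c i) z).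
have ui : u != c i.
  rewrite /u -[X in _ != X](_ : swap (c k) (c i) (c k) = _) ?(inv_eq (swapK _ _)).
    by rewrite swapK eq_sym.
  by rewrite /swap eqxx.
have tk : t (c k) = c i.
  by rewrite /t {2}/swap eqxx /swap [c i == u]eq_sym (negPf ui) (negPf ij).
have tl : t (c l) = c j by rewrite /t -/u /swap eqxx.
have injt : injective t by apply: inj_comp; apply: inv_inj; exact: swapK.
have [z|phi bij_phi phiE] := @colored_bijection _ _ _ (t \o c) c.
  transitivity (s (swap (c k) (c i) (swap u (c j) z))); last by rewrite !swapS.
  by apply: eq_card => x; rewrite !inE /= /t !(inv_eq (swapK _ _)).
have inj_phi := bij_inj bij_phi.
(* The inner transposition moves [phi k] to [i]; the outer one then moves the image of [l] to [j],
   leaving [i] fixed because its colour differs. *)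
pose psi x := tperm (tperm (phi k) i (phi l)) j (tperm (phi k) i (phi x)).
have ctp x y z : c x = c y -> c (tperm x y z) = c z.
  by move=> cxy; case: tpermP => // ->.
have cki : c (phi k) = c i by rewrite phiE.
have clj : c (tperm (phi k) i (phi l)) = c j by rewrite ctp // phiE.
have cpsi x : c (psi x) = t (c x) by rewrite /psi !ctp // phiE.
have inj_psi : injective psi by move=> x y /perm_inj/perm_inj/inj_phi.
exists psi.
  split=> [|x y]; first exact: injF_bij.
  by rewrite !cE !cpsi (inj_eq inj_psi) (inj_eq injt).
left; split; last by rewrite /psi tpermL.
rewrite /psi tpermL tpermD //; last by apply: contraNneq ij => ->.
apply: contraNneq kl => /(canRL (tpermK _ _)); rewrite tpermR => /inj_phi ->.
by [].
Qed.

End ColoredDominance.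

(** * Dominance for the listed graphs *)

Lemma coloring_false (G : graph) (c : G -> nat) x y :
  coloring false c -> adj x y = (c x != c y).
Proof. by move->; case: (x =P y) => [->|_]; rewrite ?eqxx // eqbF_neg. Qed.

Lemma coloring_twins (G : graph) (c : G -> nat) k l :
  coloring false c -> c k = c l -> twins k l.
Proof.
move=> cE ckl; split=> [|y]; first by rewrite cE ckl eqxx andbF.
by rewrite !(coloring_false _ _ cE) ckl.
Qed.

(** The size condition makes all edges equivalent under automorphisms. Two vertices of one part are
    twins, so [k] becomes isolated and an edge from [k] to another part takes over. *)
Lemma dominated_multipartite (G : graph) (c : G -> nat) :
  coloring false c -> (exists i j, c i != c j) ->
  (forall k l i j, c k != c l -> c i != c j ->
     (class_size c k = class_size c i /\ class_size c l = class_size c j) \/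
     (class_size c k = class_size c j /\ class_size c l = class_size c i)) ->
  dominated G.
Proof.
move=> cE [i [j ij]] sizes.
have aut k l : c k != c l -> pair_aut k l i j.
  move=> kl; have [[ki lj]|[kj li]] := sizes k l i j kl ij.
    exact (colored_pair_aut cE kl ij ki lj).
  have [|p Hp [Hkl|Hkl]] := colored_pair_aut cE kl _ kj li; first by rewrite eq_sym.
    by exists p => //; right.
  by exists p => //; left.
exists i, j; split=> [|k l kl]; first by apply: contraNneq ij => ->.
have [ckl|/aut] := eqVneq (c k) (c l); last by left.
have [y cy] : exists y, c y != c k.
  have [cik|] := eqVneq (c i) (c k); last by exists i.
  by exists j; rewrite -cik eq_sym.
right; exists k, y; split.
- by left; split=> //; exact: coloring_twins cE ckl.
- by apply: contraNneq cy => ->.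
- by apply: contraNneq cy => ->; rewrite ckl.
- by apply: aut; rewrite eq_sym.
Qed.

Lemma pair_aut_sym (G : graph) (k l i j : G) :
  pair_aut k l i j -> pair_aut l k i j.
Proof. by case=> p Hp [[? ?]|[? ?]]; exists p => //; [right | left]. Qed.

Lemma dominated_equal_parts (G : graph) r k : 2 <= r -> 1 <= k ->
  colored false G (fun z => (z < r) * k) -> dominated G.
Proof.
move=> r2 k1 [c cE cs].
have colorE z : z < r -> exists x, c x = z.
  move=> zr; have: 0 < #|[set x | c x == z]| by rewrite cs zr mul1n.
  by case/card_gt0P => x; rewrite inE => /eqP; exists x.
have cr x : c x < r.
  by apply: color_lt cs _ => z; rewrite leqNgt => /negPf->.
apply: (dominated_multipartite cE).
  have [x x0] := colorE 0 (ltnW r2); have [y y0] := colorE 1 r2.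
  by exists x, y; rewrite x0 y0.
by move=> *; left; rewrite /class_size !cs !cr.
Qed.

Lemma dominated_bipartite (G : graph) k m : 1 <= k -> 1 <= m ->
  colored false G (fun z => if z < 1 then (z == 0) * k else (z - 1 == 0) * m) ->
  dominated G.
Proof.
move=> k1 m1 [c cE cs].
have c2 x : c x < 2 by apply: color_lt cs _ => -[|[|z]].
have colorE z : z < 2 -> exists x, c x = z.
  move=> z2; have: 0 < #|[set x | c x == z]|.
    by rewrite cs; case: z z2 => [|[|]] //= _; rewrite ?mul1n ?subn1 ?mul1n.
  by case/card_gt0P => x; rewrite inE => /eqP; exists x.
apply: (dominated_multipartite cE).
  have [x x0] := colorE 0 isT; have [y y0] := colorE 1 isT.
  by exists x, y; rewrite x0 y0.
move=> x y u v; rewrite /class_size.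
move: (c2 x) (c2 y) (c2 u) (c2 v).
(* Only four colour patterns have both pairs in different parts; the reversed ones need the second
   alternative. *)
by case: (c x) (c y) (c u) (c v) => [|[|?]] [|[|?]] [|[|?]] [|[|?]] //= *;
  [left|right|right|left].
Qed.

(** The dominating pair joins a singleton part to the large part. *)
Lemma dominated_book (G : graph) m : 2 <= m ->
  colored false G (fun z => if z < 2 then (z < 2) * 1 else (z - 2 == 0) * m) ->
  dominated G.
Proof.
move=> m2 [c cE cs].
have c3 x : c x < 3 by apply: color_lt cs _ => -[|[|[|z]]].
have c_card z : #|[set x | c x == z]| = if z < 2 then 1 else (z == 2) * m.
  by rewrite cs; case: z => [|[|[|z]]].
have size_lt2 x : c x < 2 -> class_size c x = 1.
  by move=> cx; rewrite /class_size c_card cx.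
have size_2 x : c x = 2 -> class_size c x = m.
  by move=> cx; rewrite /class_size c_card cx mul1n.
have colorE z : z < 3 -> exists x, c x = z.
  move=> z2; have: 0 < #|[set x | c x == z]|.
    by rewrite c_card; case: z z2 => [|[|[|]]] //= _; rewrite mul1n ltnW.
  by case/card_gt0P => x; rewrite inE => /eqP; exists x.
have inj2 x y : c x < 2 -> c x = c y -> x = y.
  move=> cx cxy; have /eqP/cards1P[v /setP vE] := size_lt2 x cx.
  by have := (vE x, vE y); rewrite !inE cxy eqxx => -[/esym/eqP-> /esym/eqP->].
have [i ci] := colorE 0 isT; have [j cj] := colorE 2 isT.
have aut k l : c k < 2 -> c l = 2 -> pair_aut k l i j.
  move=> ck cl; apply: (colored_pair_aut cE).
  - by rewrite cl ltn_eqF.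
  - by rewrite ci cj.
  - by rewrite !size_lt2 ?ci.
  - by rewrite !size_2.
have aut' k l : c k = 2 -> c l < 2 -> pair_aut k l i j.
  by move=> ck cl; apply/pair_aut_sym/aut.
have le2 x : (c x < 2) || (c x == 2).
  by have := c3 x; rewrite ltnS leq_eqVlt orbC.
exists i, j; split=> [|k l kl]; first by apply: contra_eq_neq ci => ->; rewrite cj.
have [ck|/eqP ck] := orP (le2 k); have [cl|/eqP cl] := orP (le2 l).
(* Here [k] and [l] are the two singleton parts, and every vertex of the large part, such as [j], is
   an apex of them. *)
- right; exists j, k.
  have ckl : c k != c l by apply: contraNneq kl => /(inj2 _ _ ck)->.
  split=> //; last exact: aut'; last by apply: contra_eq_neq cj => ->; rewrite ltn_eqF.
  right=> y; rewrite (coloring_false _ _ cE) cj eq_sym.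
  apply/idP/orP => [cy|yE]; last by case: yE => /eqP->; rewrite ltn_eqF.
  have {}cy : c y < 2 by have := le2 y; rewrite (negPf cy) orbF.
  suff: (c y == c k) || (c y == c l).
    by case/orP => /eqP/(inj2 _ _ cy)->; [left | right].
  by move: cy ck cl ckl; case: (c y) (c k) (c l) => [|[|?]] [|[|?]] [|[|?]].
- by left; exact: aut.
- by left; exact: aut'.
right; exists k, i; split.
- by left; split=> //; apply: (coloring_twins cE); rewrite ck cl.
- by apply: contra_eq_neq ck => ->; rewrite ci.
- by apply: contra_eq_neq ci => ->; rewrite cl.
- by apply: aut'; rewrite ?ci.
Qed.

(** The dominating pair lies in two different triangles; for a pair within a triangle, the third
    vertex is an apex. *)
Lemma dominated_triangles (G : graph) r : 2 <= r ->
  colored true G (fun z => (z < r) * 3) -> dominated G.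
Proof.
move=> r2 [c cE cs].
have colorE z : z < r -> exists x, c x = z.
  move=> zr; have: 0 < #|[set x | c x == z]| by rewrite cs zr.
  by case/card_gt0P => x; rewrite inE => /eqP; exists x.
have cr x : c x < r.
  by apply: color_lt cs _ => z; rewrite leqNgt => /negPf->.
have size3 x : class_size c x = 3 by rewrite /class_size cs cr.
have [i ci] := colorE 0 (ltnW r2); have [j cj] := colorE 1 r2.
have aut k l : c k != c l -> pair_aut k l i j.
  by move=> kl; apply: (colored_pair_aut cE); rewrite ?size3 // ci cj.
exists i, j; split=> [|k l kl]; first by apply: contra_eq_neq ci => ->; rewrite cj.
have [ckl|/aut] := eqVneq (c k) (c l); last by left.
have [y cy] : exists y, c y != c k.
  have [ck0|] := eqVneq (c i) (c k); last by exists i.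
  by exists j; rewrite -ck0 ci cj.
have: #|[set x | c x == c k] :\ k :\ l| = 1.
  have := size3 k; rewrite /class_size (cardsD1 k) inE eqxx (cardsD1 l) !inE.
  by rewrite eq_sym kl ckl eqxx => -[].
move/eqP/cards1P => [x /setP xE].
have xP z : (z == x) = [&& z != l, z != k & c z == c k].
  by have := xE z; rewrite !inE => ->.
have /and3P[xl xk /eqP cx] : [&& x != l, x != k & c x == c k] by rewrite -xP.
right; exists x, y; split=> //.
- right=> z; rewrite cE cx eqb_id.
  apply/andP/orP => [[xz /eqP ckz]|[]/eqP->]; rewrite ?ckl ?eqxx //.
  have := xP z; rewrite eq_sym (negPf xz) -ckz eqxx andbT => /esym/negbT.
  by rewrite negb_and !negbK => /orP[]; [right | left].
- by apply: contraNneq cy => <-; rewrite cx.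
- by apply: contraNneq cy => ->; rewrite ckl.
- by apply: aut; rewrite cx eq_sym.
Qed.

Lemma adj_C5 (x y : C5) : adj x y = (y == ordS x) || (x == ordS y).
Proof.
apply/idP/orP => [xy|[]/eqP->]; last 2 first.
- by apply/imsetP; exists x.
- by rewrite adj_sym; apply/imsetP; exists y.
have /imsetP[z _ /setP zE] := xy; have := adj_neq xy.
have := (zE x, zE y); rewrite !inE !eqxx orbT /=.
case=> /esym/orP[]/eqP-> /esym/orP[]/eqP->; rewrite ?eqxx // => _;
  by [left | right].
Qed.

(** Rotations make all edges equivalent, and two non-adjacent vertices have their common neighbour
    as apex. *)
Lemma dominated_C5 : dominated C5.
Proof.
have aut (k l : C5) : adj k l -> pair_aut k l ord0 (ordS ord0).
  have rot_aut m : bijective (iter m (@ordS 5)) /\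
      (forall x y : C5, adj (iter m (@ordS 5) x : C5) (iter m (@ordS 5) y) = adj x y).
    split; first by elim: m => [|m IHm]; [exists id | apply: bij_comp (ordS_bij _) IHm].
    move=> x y; elim: m => //= m IHm; rewrite -IHm !adj_C5.
    by rewrite !(inj_eq (@ordS_inj _)).
  have rot0 (x : 'I_5) : iter (5 - x) (@ordS 5) x = ord0.
    by case: x => -[|[|[|[|[|]]]]] // ?; apply: val_inj.
  rewrite adj_C5 => /orP[]/eqP->.
    exists (iter (5 - k) (@ordS 5)); first exact: rot_aut.
    by left; rewrite -iterSr iterS rot0.
  exists (iter (5 - l) (@ordS 5)); first exact: rot_aut.
  by right; rewrite -iterSr iterS rot0.
exists ord0, (ordS ord0); split=> // k l kl.
have [/aut|nkl] := boolP (adj k l); first by left.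
right.
suff [x xkl] : exists x : C5, apex x k l.
  have [xk xl] := apex_neq xkl.
  exists x, k; split=> //; first by right.
  by apply: aut; rewrite xkl eqxx.
suff [->|->] : l = ordS (ordS k) \/ k = ordS (ordS l).
- exists (ordS k) => y; rewrite adj_C5 (inj_eq (@ordS_inj _)) orbC.
  by rewrite [k == y]eq_sym.
- exists (ordS l) => y; rewrite adj_C5 (inj_eq (@ordS_inj _)).
  by rewrite [l == y]eq_sym.
move: kl nkl; rewrite adj_C5; case: k l => -[|[|[|[|[|]]]]] // ? [] [|[|[|[|[|]]]]] // ?;
  by [left; apply: val_inj|right; apply: val_inj].
Qed.

(** * Necessary conditions *)

(** This is what the maximality of the minor identifying [i] and [j] implies in terms of the graph
    alone. *)
Definition dominant_pair (G : graph) (i j : G) :=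
  i != j /\ forall k l : G, k != l ->
  [\/ twins k l, exists x, apex x k l |
     adj k l = adj i j /\ (adj i j -> #|skew_nbrs k l| = #|skew_nbrs i j|)].

Lemma join_irreducible_dominant n (E : {set {set 'I_n}})
    (E_loopless : loopless_edges E) :
  0 < n -> join_irreducible (edge_fun E) ->
  exists i j : delete_isolated (Graph E_loopless), dominant_pair i j.
Proof.
move=> n0 /(join_irreducibleP _ n0)[i0 [j0 []]].
rewrite (ess_edge_fun E_loopless); set G := Graph E_loopless => iS jS ij maxij.
have valS (u : delete_isolated G) : val u \in non_isolated_set G.
  by rewrite non_isolatedE (valP u).
have SubS (x : G) : x \in non_isolated_set G ->
    exists u : delete_isolated G, x = val u.
  by rewrite non_isolatedE => xS; exists (Sub x xS).
(* A vertex in [skew_nbrs] is adjacent to one of the two vertices, so it survives the deletion of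
   isolated vertices. *)
have skewE (k l : delete_isolated G) :
    #|skew_nbrs (val k) (val l)| = #|skew_nbrs k l|.
  rewrite -(card_imset _ val_inj); apply: eq_card => x.
  apply/idP/imsetP => [|[u uS ->]]; last first.
    by move: uS; rewrite !inE !adj_delete_isolated !(inj_eq val_inj).
  rewrite !inE => xs.
  have /SubS[u xE] : x \in non_isolated_set G.
    case/and3P: xs => _ _; case akx: (adj _ x) => axl.
      by rewrite adj_sym in akx; exact: adj_non_isolated akx.
    apply: (@adj_non_isolated _ x (val l)); rewrite adj_sym.
    by move: axl; case: (adj _ x).
  exists u => //; move: xs; rewrite xE !inE !adj_delete_isolated.
  by rewrite !(inj_eq val_inj).
have [i iE] := SubS _ iS; have [j jE] := SubS _ jS; exists i, j.
split=> [|k l kl]; first by rewrite -(inj_eq val_inj) -iE -jE.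
have kl' : val k != val l by rewrite (inj_eq val_inj).
have := maxij _ _ (valS k) (valS l) kl'; rewrite iE jE in iS jS ij *.
move/(minor_identify_dichotomy iS jS ij (valS k) (valS l) kl').
case=> [[nkl eqN]|[x xkl]|[aE skE]].
- constructor 1; split=> [|y]; rewrite !adj_delete_isolated //; exact: eqN.
- constructor 2; have /SubS[u xE] : x \in non_isolated_set G.
    by apply: (@adj_non_isolated _ x (val k)); rewrite xkl eqxx.
  by exists u => y; rewrite adj_delete_isolated -xE xkl !(inj_eq val_inj).
by constructor 3; rewrite !adj_delete_isolated; rewrite -!skewE.
Qed.

Lemma delete_isolated_adj (G : graph) (u : delete_isolated G) : exists v, adj u v.
Proof.
have := valP u; rewrite -non_isolatedE => /non_isolatedP[y uy].
have yS : [exists e in edges G, y \in e].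
  by rewrite -non_isolatedE; apply: (@adj_non_isolated _ y (val u)); rewrite adj_sym.
by exists (Sub y yS); rewrite adj_delete_isolated.
Qed.

Section Classification.
Variable G : graph.
Implicit Types x y i j k l : G.

(** Here [P] gives the classes of an equivalence relation; a vertex is coloured by the position of
    its class in an enumeration of the classes. *)
Lemma colored_classes b (P : G -> {set G}) t :
  (forall x, x \in P x) -> (forall x y, y \in P x -> P y = P x) ->
  (forall x, #|P x| = t) ->
  (forall x y, adj x y = (x != y) && ((y \in P x) == b)) ->
  (exists x y, y \notin P x) ->
  exists2 r, 2 <= r & colored b G (fun z => (z < r) * t).
Proof.
move=> Prefl Peq Pt adjE [x0 [y0 xy0]].
have PE x y : (y \in P x) = (P x == P y).
  by apply/idP/eqP => [/Peq->|->].
pose D := P @: [set: G].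
have DP x : P x \in enum D by rewrite mem_enum imset_f.
exists #|D|.
  rewrite (cardsD1 (P x0)) imset_f // ltnS; apply/card_gt0P; exists (P y0).
  by rewrite !inE imset_f // andbT eq_sym -PE.
exists (fun x => index (P x) (enum D)) => [x y|z].
  rewrite adjE PE; congr (_ && (_ == b)).
  apply/eqP/eqP => [->//|eq_i].
  by rewrite -(nth_index set0 (DP x)) eq_i nth_index.
have [zD|Dz] := ltnP z #|D|; last first.
  apply: eq_card0 => x; rewrite !inE; apply: ltn_eqF.
  by apply: leq_trans Dz; rewrite cardE index_mem.
rewrite mul1n; rewrite cardE in zD.
have: nth set0 (enum D) z \in D by rewrite -mem_enum mem_nth.
case/imsetP => x _ nzE; rewrite -(Pt x); apply: eq_card => y; rewrite !inE PE -nzE.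
apply/eqP/eqP => [<-|<-]; first by rewrite nth_index.
by rewrite index_uniq // enum_uniq.
Qed.

(** An edge [xy] has an apex [z], and the apexes of [xz] and [yz] can only be [y] and [x]. So every
    component is a triangle, and the non-edge provides a second one. *)
Lemma edge_apex_colored :
  (forall x, exists y, adj x y) -> (forall k l, adj k l -> exists x, apex x k l) ->
  (exists i j, (i != j) && ~~ adj i j) ->
  exists2 r, 2 <= r & colored true G (fun z => (z < r) * 3).
Proof.
move=> noniso apexE [i [j /andP[ij nij]]].
have cl3 x : exists y z, [/\ apex x y z, apex y x z & apex z x y].
  have [y xy] := noniso x; have [z zxy] := apexE x y xy.
  have [zx zy] := apex_neq zxy.
  have xz : adj x z by rewrite adj_sym zxy eqxx.
  have yz : adj y z by rewrite adj_sym zxy eqxx orbT.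
  have [u uxz] := apexE _ _ xz; have [v vyz] := apexE _ _ yz.
  have uy : u = y.
    have: adj z u by rewrite adj_sym uxz eqxx orbT.
    by rewrite zxy (negPf (apex_neq uxz).1) => /eqP.
  have vx : v = x.
    have: adj z v by rewrite adj_sym vyz eqxx orbT.
    by rewrite zxy (negPf (apex_neq vyz).1) orbF => /eqP.
  by rewrite uy in uxz; rewrite vx in vyz; exists y, z.
apply: (@colored_classes _ (fun x => x |: [set y | adj x y])).
- by move=> x; rewrite !inE eqxx.
- move=> x y; have [u [v [xuv uxv vxu]]] := cl3 x.
  rewrite !inE => /orP[/eqP->//|]; rewrite xuv => /orP[]/eqP->; apply/setP => z;
    rewrite !inE ?xuv ?uxv ?vxu; by do 3![case: eqP => //].
- move=> x; have [u [v [xuv uxv vxu]]] := cl3 x.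
  have -> : x |: [set y | adj x y] = [set x; u; v].
    by apply/setP => y; rewrite !inE xuv orbA.
  have [xu xv] := apex_neq xuv; have [_ uv] := apex_neq uxv.
  by rewrite setUC cardsU1 cards2 !inE negb_or [v == x]eq_sym [v == u]eq_sym xu xv uv.
- move=> x y; rewrite !inE eqb_id; case: (x =P y) => [->|/eqP xy] /=.
    by rewrite adj_irr.
  by rewrite eq_sym (negPf xy).
- by exists i, j; rewrite !inE eq_sym (negPf ij).
Qed.

(** * Graphs whose non-edges are twins or have an apex *)

Section NonEdges.
Hypothesis twin_or_apex : forall k l, k != l -> ~~ adj k l ->
  twins k l \/ exists x, apex x k l.

Lemma nonadj_apex k l z : k != l -> ~~ adj k l -> adj k z != adj l z ->
  exists x, apex x k l.
Proof.
by move=> kl nkl kzl; have [[_ /(_ z)/eqP]|//] := twin_or_apex kl nkl; rewrite (negPf kzl).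
Qed.

(** With [m] the apex of [k], [l] and [q] that of [p], [l], the vertices [l], [m], [k], [p], [q]
    form a 5-cycle. Each turns out to be an apex of its two neighbours on it. *)
Lemma nonedge_apex_C5 k l p : k != l -> ~~ adj k l -> adj k p -> ~~ adj l p ->
  graph_iso G C5.
Proof.
move=> kl nkl kp nlp.
have neq x y z : adj x z -> ~~ adj y z -> x != y.
  by move=> xz; apply: contraNneq => <-.
have [m mkl] : exists m, apex m k l.
  by apply: (nonadj_apex kl nkl (z := p)); rewrite kp (negPf nlp).
have mk : adj m k by rewrite mkl eqxx.
have ml : adj m l by rewrite mkl eqxx orbT.
have pl : p != l by apply: (neq _ _ k); rewrite adj_sym.
have npl : ~~ adj p l by rewrite adj_sym.
have mp : m != p by apply: neq ml npl.
have pk : p != k by rewrite eq_sym adj_neq.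
have nmp : ~~ adj m p by rewrite mkl negb_or pk.
have kmp : apex k m p.
  (* An apex of the non-edge [mp] is a neighbour of [m], hence [k] or [l], and [l] is not adjacent
     to [p]. The same argument yields [pkq] and [lmq]. *)
  have [|q qmp] := nonadj_apex mp nmp (z := l); first by rewrite ml (negPf npl).
  have: adj m q by rewrite adj_sym qmp eqxx.
  rewrite mkl => /orP[]/eqP qE; first by rewrite -qE.
  by move: nlp; rewrite -qE qmp eqxx orbT.
have [q qpl] : exists q, apex q p l.
  apply: (nonadj_apex pl npl (z := k)).
  by rewrite adj_sym kp adj_sym (negPf nkl).
have qp : adj q p by rewrite qpl eqxx.
have ql : adj q l by rewrite qpl eqxx orbT.
have kq : k != q by rewrite eq_sym; exact: neq ql nkl.
have mq : m != q by rewrite eq_sym; exact: neq qp nmp.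
have ml' : m != l by exact: adj_neq.
have nqm : ~~ adj q m by rewrite qpl negb_or mp.
have nqk : ~~ adj q k by rewrite qpl negb_or eq_sym pk.
have pkq : apex p k q.
  have [||r rkq] := nonadj_apex kq _ (z := m); first by rewrite adj_sym.
    by rewrite adj_sym mk (negPf nqm).
  have: adj k r by rewrite adj_sym rkq eqxx.
  rewrite kmp => /orP[]/eqP rE; last by rewrite -rE.
  by move: nqm; rewrite adj_sym -rE rkq eqxx orbT.
have lmq : apex l m q.
  have [||r rmq] := nonadj_apex mq _ (z := k); first by rewrite adj_sym.
    by rewrite mk (negPf nqk).
  have: adj m r by rewrite adj_sym rmq eqxx.
  rewrite mkl => /orP[]/eqP rE; last by rewrite -rE.
  by move: nqk; rewrite adj_sym -rE rmq eqxx orbT.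
have all5 z : z \in [:: l; m; k; p; q].
  (* A further vertex [z] would be told apart from [k] by [m], so [zk] would have an apex; that is
     [m] or [p], neither of which is adjacent to [z]. *)
  apply: contraT; rewrite !inE !negb_or => /and5P[zl zm zk zp zq].
  have [||r rzk] := nonadj_apex zk _ (z := m).
  - by rewrite adj_sym kmp negb_or zm.
  - by rewrite [adj k m]adj_sym mk adj_sym mkl (negPf zk) (negPf zl).
  have: adj k r by rewrite adj_sym rzk eqxx orbT.
  have rz : adj r z by rewrite rzk eqxx.
  rewrite kmp => /orP[]/eqP rE; move: rz; rewrite rE ?mkl ?pkq.
    by rewrite (negPf zk) (negPf zl).
  by rewrite (negPf zk) (negPf zq).
have uniq5 : uniq [:: l; m; k; p; q].
  rewrite /= !inE !negb_or [l == m]eq_sym ml' [l == k]eq_sym kl [l == p]eq_sym pl.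
  rewrite [l == q]eq_sym (adj_neq ql) (adj_neq mk) mp mq [k == p]eq_sym pk kq.
  by rewrite eq_sym (adj_neq qp).
apply: graph_iso_sym; apply/graph_isoP.
pose phi (u : C5) := nth l [:: l; m; k; p; q] u.
have inj_phi : injective phi.
  by move=> u v /eqP; rewrite nth_uniq //= => /eqP/val_inj.
exists phi.
  apply: inj_card_bij => //; rewrite [#|C5|]card_ord.
  rewrite -[5]/(size [:: l; m; k; p; q]) -(card_uniqP uniq5).
  by apply: subset_leq_card; apply/subsetP => z _; exact: all5.
have apexE u : apex (phi u) (phi (ordS u)) (phi (ord_pred u)).
  by case: u => -[|[|[|[|[|]]]]] //= ? z; rewrite /phi /= ?lmq ?mkl ?kmp ?pkq ?qpl // orbC.
move=> u v; rewrite apexE adj_C5 !(inj_eq inj_phi).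
by rewrite [u == _]eq_sym (can2_eq (@ordSK _) (@ord_predK _)).
Qed.

End NonEdges.

(** * Complete multipartite graphs *)

Section Multipartite.
Hypothesis nonadj_eq : forall x y z, ~~ adj x y -> adj x z = adj y z.

(** By [nonadj_eq], non-adjacency is an equivalence relation, and [P x] is the part containing
    [x]. *)
Let P x := [set y | ~~ adj x y].

Let P_refl x : x \in P x.
Proof. by rewrite inE adj_irr. Qed.

Let P_eq x y : y \in P x -> P y = P x.
Proof.
by rewrite inE => nxy; apply/setP => z; rewrite !inE (nonadj_eq z nxy).
Qed.

Let adjP x y : adj x y = (x != y) && ((y \in P x) == false).
Proof. by rewrite inE eqbF_neg negbK; case: eqP => // ->; rewrite adj_irr. Qed.

(** A vertex is adjacent to exactly one of [k] and [l] iff it lies in one of their two disjoint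
    parts; the 2 accounts for [k] and [l] themselves. *)
Lemma card_skew_nbrs k l : adj k l -> #|skew_nbrs k l|.+2 = #|P k| + #|P l|.
Proof.
move=> akl; have kl := adj_neq akl.
have disj : P k :&: P l = set0.
  apply/setP => z; rewrite !inE; apply/andP => -[nkz nlz].
  by move: akl; rewrite adj_sym (nonadj_eq k nlz) adj_sym (negPf nkz).
rewrite -cardsUI disj cards0 addn0 -add1n -add1n.
have <- : k |: (l |: skew_nbrs k l) = P k :|: P l.
  apply/setP => z; rewrite !inE.
  case: (z =P k) => [->|zk] /=; first by rewrite adj_irr.
  case: (z =P l) => [->|zl] /=; first by rewrite adj_irr orbT.
  have := in_set0 z; rewrite -disj !inE.
  by case: (adj k z) (adj l z) => [] [].
by rewrite cardsU1 !inE eqxx (negPf kl) /= cardsU1 !inE eqxx andbF.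
Qed.

(** Every vertex but [k] and [l] is non-adjacent to [x], hence in its part. *)
Lemma multipartite_book k l x : adj k l -> apex x k l ->
  colored false G (fun z => if z < 2 then (z < 2) * 1 else (z - 2 == 0) * #|P x|).
Proof.
move=> akl xkl; have kl := adj_neq akl.
pose c y := if y == k then 0 else if y == l then 1 else 2.
have cP y : (c y == 2) = (y \in P x).
  by rewrite inE xkl /c; case: (y == k); case: (y == l).
have adjx y z : y \in P x -> adj y z = adj x z.
  by rewrite inE => nxy; rewrite (nonadj_eq z nxy).
exists c => [y z|z].
  have yz0 : c y = 2 -> c z = 2 -> adj y z = false.
    move=> /eqP; rewrite cP => /adjx-> /eqP; rewrite cP inE; exact: negbTE.
  have side y' z' : c y' = 2 -> c z' != 2 -> adj y' z'.
    by move=> /eqP; rewrite cP => /adjx-> ; rewrite cP inE negbK.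
  rewrite eqbF_neg.
  case: (y =P z) => [->|/eqP yz] /=; first by rewrite adj_irr.
  have [cy|cy] := eqVneq (c y) 2; have [cz|cz] := eqVneq (c z) 2.
  - by rewrite yz0 // cy cz.
  - by rewrite side // cy eq_sym.
  - by rewrite adj_sym side // cz.
  move: cy cz; rewrite /c; case: (y =P k) yz => [->|_] yz.
    rewrite [z == k]eq_sym (negPf yz).
    by case: (z =P l) => [->|//]; rewrite akl.
  case: (y =P l) yz => [->|//] yz; case: (z =P k) => [->|_]; first by rewrite adj_sym akl.
  by rewrite [z == l]eq_sym (negPf yz).
case: z => [|[|[|z]]] /=.
- transitivity #|[set k]|; last by rewrite cards1.
  by apply: eq_card => y; rewrite !inE /c; case: (y == k); case: (y == l).
- transitivity #|[set l]|; last by rewrite cards1.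
  apply: eq_card => y; rewrite !inE /c.
  by case: (y =P k) => [->|_]; [rewrite (negPf kl) | case: (y == l)].
- by rewrite mul1n; apply: eq_card => y; rewrite inE cP.
- by apply: eq_card0 => y; rewrite !inE /c; case: (y == k); case: (y == l).
Qed.

Lemma multipartite_equal_parts t : (exists x y, adj x y) ->
  (forall x, #|P x| = t) ->
  exists2 r, 2 <= r & colored false G (fun z => (z < r) * t).
Proof.
move=> [x [y xy]] Pt; apply: (colored_classes P_refl P_eq Pt adjP).
by exists x, y; rewrite inE xy.
Qed.

(** A vertex of a third part would be adjacent to both [i] and [j]. *)
Lemma multipartite_bipartite i j : adj i j -> (forall x, ~~ (adj x i && adj x j)) ->
  colored false G
    (fun z => if z < 1 then (z == 0) * #|P i| else (z - 1 == 0) * #|P j|).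
Proof.
move=> aij two.
have PijE x : (x \in P j) = (x \notin P i).
  rewrite !inE negbK; apply/idP/idP => [njx|aix].
    by rewrite adj_sym -(nonadj_eq i njx) adj_sym.
  by have := two x; rewrite negb_and adj_sym aix adj_sym.
exists (fun x => (x \notin P i) : nat) => [x y|[|[|z]]].
- rewrite adjP; congr (_ && (_ == _)).
  have [xi|xi] := boolP (x \in P i); have [yi|yi] := boolP (y \in P i).
  + by rewrite (P_eq xi) yi.
  + by rewrite (P_eq xi) (negPf yi).
  + rewrite -PijE in xi; rewrite (P_eq xi) PijE yi //.
  + rewrite -!PijE in xi yi; by rewrite (P_eq xi) yi.
- by rewrite mul1n; apply: eq_card => x; rewrite !inE negbK; case: (adj i x).
- by rewrite mul1n; apply: eq_card => x; rewrite PijE inE; case: (x \in P i).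
- by apply: eq_card0 => x; rewrite !inE; case: (adj i x).
Qed.

End Multipartite.

End Classification.

(** * The classification *)

Definition listed (G : graph) :=
  (exists2 k : nat, 2 <= k &
      graph_iso G (disjoint_copies k (complete_graph 3))) \/
  graph_iso G C5 \/
  (exists2 m : nat, 2 <= m &
      graph_iso G (graph_join (complete_graph 2) (edgeless_graph m))) \/
  (exists2 k : nat, 2 <= k & graph_iso G (complete_graph k)) \/
  (exists k m : nat, 1 <= k < m /\
      graph_iso G (graph_join (edgeless_graph k) (edgeless_graph m))) \/
  (exists r k : nat, [/\ 2 <= r, 2 <= k &
      graph_iso G (join_copies r (edgeless_graph k))]).

Lemma colored_book m :
  colored false (graph_join (complete_graph 2) (edgeless_graph m))
    (fun z => if z < 2 then (z < 2) * 1 else (z - 2 == 0) * m).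
Proof.
apply: colored_sum (colored_complete 2) (colored_edgeless m) => z.
by rewrite leqNgt => /negPf->.
Qed.

Lemma colored_bipartite k m :
  colored false (graph_join (edgeless_graph k) (edgeless_graph m))
    (fun z => if z < 1 then (z == 0) * k else (z - 1 == 0) * m).
Proof. by apply: colored_sum (colored_edgeless k) (colored_edgeless m) => -[]. Qed.

Lemma listed_dominated (G : graph) : listed G -> dominated G.
Proof.
case=> [[k k2 iG]|[iG|[[m m2 iG]|[[k k2 iG]|[[k [m [/andP[k1 km] iG]]]|[r [k [r2 k2 iG]]]]]]]];
  apply: (dominated_iso iG).
- apply: (dominated_triangles k2).
  exact: (colored_copies (b := true) (ltnW k2) (colored_clique 3)).
- exact: dominated_C5.
- exact: dominated_book m2 (colored_book m).
- exact: (dominated_equal_parts (k := 1) k2 _ (colored_complete k)).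
- exact: dominated_bipartite k1 (leq_ltn_trans _ km) (colored_bipartite k m).
- apply: (dominated_equal_parts r2 (ltnW k2)).
  exact: (colored_copies (b := false) (ltnW r2) (colored_edgeless k)).
Qed.

Lemma dominant_listed (G : graph) (i j : G) :
  (forall x : G, exists y, adj x y) -> dominant_pair i j -> listed G.
Proof.
move=> noniso [ij dom]; have [aij|nij] := boolP (adj i j); last first.
  left; have [k l akl||r r2 Gr] := edge_apex_colored noniso.
  - have [[]||[]] := dom k l (adj_neq akl); rewrite ?akl //.
    by rewrite (negPf nij).
  - by exists i, j; rewrite ij.
  exists r => //; apply: colored_iso Gr _.
  exact: (colored_copies (b := true) (ltnW r2) (colored_clique 3)).
right.
have twin_or_apex (k l : G) : k != l -> ~~ adj k l ->
    twins k l \/ exists x, apex x k l.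
  move=> kl nkl; have [|//|[akl]] := dom k l kl; [by left|by right|].
  by rewrite akl aij in nkl.
have [/existsP[k /existsP[l /existsP[p /and4P[kl nkl kp nlp]]]]|noC5] := boolP
  [exists k : G, exists l : G, exists p : G,
     [&& k != l, ~~ adj k l, adj k p & ~~ adj l p]].
  by left; apply: nonedge_apex_C5 kl nkl kp nlp.
right.
have nonadj_sub (x y z : G) : ~~ adj x y -> adj x z -> adj y z.
  move=> nxy xz; apply: contraR noC5 => nyz.
  apply/existsP; exists x; apply/existsP; exists y; apply/existsP; exists z.
  by rewrite nxy xz nyz !andbT; apply: contraNneq nyz => <-.
have nonadj_eq (x y z : G) : ~~ adj x y -> adj x z = adj y z.
  move=> nxy; apply/idP/idP; first exact: nonadj_sub.
  by apply: nonadj_sub; rewrite adj_sym.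
pose w (x : G) := #|[set y | ~~ adj x y]|.
have w_gt0 x : 0 < w x.
  by apply/card_gt0P; exists x; rewrite inE adj_irr.
have [/existsP[k /existsP[l /existsP[x /andP[akl /forallP xkl]]]]|noapex] := boolP
  [exists k : G, exists l : G, exists x : G,
     adj k l && [forall y, adj x y == ((y == k) || (y == l))]].
  have Gc := multipartite_book nonadj_eq akl (fun y => eqP (xkl y)).
  (* If the part of the apex is a singleton too, the graph is [K_3]. *)
  have [w2|w1] := ltnP 1 (w x).
    by left; exists (w x) => //; apply: colored_iso Gc (colored_book _).
  right; left; exists 3 => //; apply: colored_iso _ (colored_complete 3).
  have {}w1 : w x = 1 by apply/eqP; rewrite eqn_leq w1 w_gt0.
  apply: eq_colored Gc => z; rewrite -/(w x) w1.
  by case: z => [|[|[|z]]].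
(* Without apexes, every edge gives a loop of the same degree as [ij], and [card_skew_nbrs] converts
   degrees into part sizes. *)
have wE (k l : G) : adj k l -> w k + w l = w i + w j.
  move=> akl; rewrite -!card_skew_nbrs //.
  have [[]|[x xkl]|[_ /(_ aij)->//]] := dom k l (adj_neq akl).
    by rewrite akl.
  case/negP: noapex; apply/existsP; exists k; apply/existsP; exists l.
  by apply/existsP; exists x; rewrite akl; apply/forallP => y; rewrite xkl.
right.
have [eq_w|] := boolP [forall x, w x == w i].
  have [|x|r r2 Gr] := multipartite_equal_parts nonadj_eq (t := w i).
  - by exists i, j.
  - exact/eqP/(forallP eq_w).
  have [w2|w1] := ltnP 1 (w i).
    right; right; exists r, (w i); split=> //; apply: colored_iso Gr _.
    exact: (colored_copies (b := false) (ltnW r2) (colored_edgeless _)).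
  left; exists r => //; apply: colored_iso Gr _.
  have -> : w i = 1 by apply/eqP; rewrite eqn_leq w1 w_gt0.
  exact: colored_complete.
rewrite negb_forall => /existsP[x0 wx0]; right; left.
have nadj2 x : ~~ adj x i -> ~~ adj x j -> False.
  by move=> nxi; rewrite (nonadj_eq _ _ j nxi) aij.
(* A vertex adjacent to both [i] and [j] forces [w i = w j] by [wE]; as [x0] is adjacent to [i] or
   [j], also [w x0 = w i], against its choice. *)
have two x : ~~ (adj x i && adj x j).
  apply: contra wx0 => /andP[/wE xi /wE xj].
  have eq_ij : w i = w j by apply/eqP; rewrite -(eqn_add2l (w x)) xi xj.
  have [/wE/eqP|nx0i] := boolP (adj x0 i).
    by rewrite eq_ij eqn_add2r.
  have [/wE/eqP|/(nadj2 _ nx0i)//] := boolP (adj x0 j).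
  by rewrite eqn_add2r.
have [lt_ij|lt_ji|eq_ij] := ltngtP (w i) (w j).
- exists (w i), (w j); rewrite w_gt0 lt_ij; split=> //.
  exact: colored_iso (multipartite_bipartite nonadj_eq aij two) (colored_bipartite _ _).
- exists (w j), (w i); rewrite w_gt0 lt_ji; split=> //.
  have aji : adj j i by rewrite adj_sym.
  have two' x : ~~ (adj x j && adj x i) by rewrite andbC.
  exact: colored_iso (multipartite_bipartite nonadj_eq aji two') (colored_bipartite _ _).
(* If [w i = w j], then [x0], lying in one of the two parts, cannot have a different part size. *)
have classE x y : ~~ adj x y -> w x = w y.
  by move=> nxy; apply: eq_card => z; rewrite !inE (nonadj_eq _ _ z nxy).
case/negP: wx0; have [x0i|/classE->//] := boolP (adj x0 i).
by have := two x0; rewrite x0i => /classE->; rewrite eq_ij.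
Qed.

Theorem theorem4p8 (n : nat) (n_gt0 : 0 < n) (E : {set {set 'I_n}})
    (E_loopless : loopless_edges E) :
  join_irreducible (edge_fun E) <->
  let G' := delete_isolated (Graph E_loopless) in
  (exists2 k : nat, 2 <= k &
      graph_iso G' (disjoint_copies k (complete_graph 3))) \/
  graph_iso G' C5 \/
  (exists2 m : nat, 2 <= m &
      graph_iso G' (graph_join (complete_graph 2) (edgeless_graph m))) \/
  (exists2 k : nat, 2 <= k & graph_iso G' (complete_graph k)) \/
  (exists k m : nat, 1 <= k < m /\
      graph_iso G' (graph_join (edgeless_graph k) (edgeless_graph m))) \/
  (exists r k : nat, [/\ 2 <= r, 2 <= k &
      graph_iso G' (join_copies r (edgeless_graph k))]).
Proof.
change (join_irreducible (edge_fun E) <->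
        listed (delete_isolated (Graph E_loopless))).
split=> [JI|/listed_dominated]; last exact: dominated_join_irreducible.
have [i [j]] := join_irreducible_dominant E_loopless n_gt0 JI.
exact/dominant_listed/delete_isolated_adj.
Qed.
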